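(* The property of being presentable by a product is not invariant under quasi-isometries, under measure equivalence, or under orbit equivalence. That is: (i) there exist quasi-isometric finitely generated groups one of which is presentable by a product and the other not; (ii) there exist measure equivalent finitely generated groups one of which is presentable by a product and the other not; (iii) there exist finitely generated groups admitting orbit equivalent free probability-measure-preserving actions on standard Borel probability spaces, one of which is presentable by a product and the other not.
   Context: An infinite group $\Gamma$ is presentable by a product if there exist groups $\Gamma_1,\Gamma_2$ and a homomorphism $\varphi\colon\Gamma_1\times\Gamma_2\to\Gamma$ whose image has finite index in $\Gamma$ and such that both $\varphi(\Gamma_1)$ and $\varphi(\Gamma_2)$ are infinite. *)

(* Defs.v *)
From HB Require Import structures.
From mathcomp Require Import all_boot all_order all_algebra.
From mathcomp Require Import all_classical all_reals all_analysis.
From mathcomp Require Import Rstruct.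

Set Implicit Arguments.
Unset Strict Implicit.
Unset Printing Implicit Defensive.

Import Order.TTheory GRing.Theory Num.Theory.
Local Open Scope classical_set_scope.
Local Open Scope ring_scope.

Notation RR := Rdefinitions.R.

Notation gmul := (@monoid.mul _).
Notation gone := (@monoid.one _).
Notation ginv := (@monoid.inv _).

Definition infinite_group (G : groupType) : Prop := ~ finite_set (@setT G).

Definition letter (G : groupType) (l : bool * G) : G :=
  if l.1 then ginv l.2 else l.2.

Definition eval_word (G : groupType) (w : seq (bool * G)) : G :=
  foldr (fun l acc => gmul (letter l) acc) gone w.

Definition word_over (G : groupType) (S : seq G) (w : seq (bool * G)) : Prop :=
  all (fun l => l.2 \in S) w.

Definition generates (G : groupType) (S : seq G) : Prop :=
  forall g : G, exists w, word_over S w /\ eval_word w = g.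

Definition finitely_generated (G : groupType) : Prop :=
  exists S : seq G, generates S.

Definition wl_le (G : groupType) (S : seq G) (g : G) (n : nat) : Prop :=
  exists w, word_over S w /\ eval_word w = g /\ (size w <= n)%N.

(* word length |g|_S : the least such n (0 if S does not generate g) *)
Definition word_length (G : groupType) (S : seq G) (g : G) : nat :=
  xget 0%N [set n | wl_le S g n /\ forall m, wl_le S g m -> (n <= m)%N].

Definition word_dist (G : groupType) (S : seq G) (g h : G) : nat :=
  word_length S (gmul (ginv g) h).

Definition quasi_isometric (G H : groupType) : Prop :=
  exists (S : seq G) (T : seq H), generates S /\ generates T /\
  exists (f : G -> H) (K C : nat), (1 <= K)%N /\
    (forall x y : G,
       (word_dist S x y <= K * word_dist T (f x) (f y) + C)%N /\
       (word_dist T (f x) (f y) <= K * word_dist S x y + C)%N) /\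
    (forall z : H, exists x : G, (word_dist T z (f x) <= C)%N).

Definition presentable_by_product (Gam : groupType) : Prop :=
  infinite_group Gam /\
  exists (G1 G2 : groupType) (phi : G1 * G2 -> Gam),
    (forall p q : G1 * G2,
        phi (gmul p.1 q.1, gmul p.2 q.2) = gmul (phi p) (phi q)) /\
    (exists s : seq Gam, forall g : Gam,
        exists t, t \in s /\ exists p, g = gmul t (phi p)) /\
    ~ finite_set [set phi (x, gone) | x in @setT G1] /\
    ~ finite_set [set phi (gone, y) | y in @setT G2].

Definition standard_borel (d : measure_display) (X : measurableType d) : Prop :=
  exists (e : X -> measurableTypeR RR) (B : set (measurableTypeR RR)),
    measurable B /\ injective e /\ range e = B /\
    measurable_fun setT e /\
    (forall A : set X, measurable A -> measurable (e @` A)).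

Definition mp_action (G : groupType) (d : measure_display) (X : measurableType d)
    (m : {measure set X -> \bar RR}) (a : G -> X -> X) : Prop :=
  (forall x, a gone x = x) /\
  (forall g h x, a (gmul g h) x = a g (a h x)) /\
  (forall g, measurable_fun setT (a g)) /\
  (forall g (A : set X), measurable A -> m (a g @^-1` A) = m A).

Definition free_action (G : groupType) (X : Type) (a : G -> X -> X) : Prop :=
  forall g x, a g x = x -> g = gone.

Definition finite_fundamental_domain (G : groupType) (d : measure_display)
    (X : measurableType d) (m : {measure set X -> \bar RR}) (a : G -> X -> X)
    (F : set X) : Prop :=
  measurable F /\ (forall x, exists! g : G, F (a (ginv g) x)) /\
  (m F < +oo)%E.

Definition measure_equivalent (G H : groupType) : Prop :=
  exists (d : measure_display) (Om : measurableType d)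
         (m : {measure set Om -> \bar RR})
         (a : G -> Om -> Om) (b : H -> Om -> Om),
    standard_borel Om /\ sigma_finite setT m /\ (0 < m setT)%E /\
    mp_action m a /\ mp_action m b /\ free_action a /\ free_action b /\
    (forall g h x, a g (b h x) = b h (a g x)) /\
    (exists F, finite_fundamental_domain m a F) /\
    (exists F, finite_fundamental_domain m b F).

Definition orbit (G : groupType) (X : Type) (a : G -> X -> X) (x : X) : set X :=
  [set a g x | g in @setT G].

Definition orbit_equivalent (G H : groupType)
    (dX : measure_display) (X : measurableType dX) (mu : probability X RR)
    (a : G -> X -> X)
    (dY : measure_display) (Y : measurableType dY) (nu : probability Y RR)
    (b : H -> Y -> Y) : Prop :=
  exists (X0 : set X) (Y0 : set Y) (T : X -> Y),
    measurable X0 /\ measurable Y0 /\ mu (~` X0) = 0%E /\ nu (~` Y0) = 0%E /\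
    set_bij X0 Y0 T /\ measurable_fun X0 T /\
    (forall A : set X, measurable A -> A `<=` X0 ->
        measurable (T @` A) /\ nu (T @` A) = mu A) /\
    (forall x, X0 x -> T @` (orbit a x `&` X0) = orbit b (T x) `&` Y0).

(* Main.v *)
Require Import Defs.
From HB Require Import structures.
From mathcomp Require Import all_boot all_order all_algebra.
From mathcomp Require Import all_classical all_reals all_analysis.
From mathcomp Require Import Rstruct.
From mathcomp Require Import finmap measurable_realfun.
From mathcomp Require Import ring lra zify.

(** For (i), the Hamilton quaternions of norm 5 and 13 that are congruent to 1
    modulo 2, taken modulo scalars, generate a group [lattice65] with an exact
    factorization [A B = B A], [A] and [B] being generated by the quaternions of
    norm 5 and 13 respectively, and the two generating sets exchange with each
    other.  Writing [g = a b = b' a'], the map [g |-> (a, b')] is an isomorphism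
    of the Cayley graphs of [lattice65] and [A x B].  In [lattice65] commuting
    elements are rotations about the same axis, so no product of two infinite
    commuting subgroups has finite index.

    For (ii) and (iii), [Z^2] is compared with the lamplighter group
    [Z/2 wr Z].  On pairs [(z, y)] of binary sequences, [Z^2] acts by two
    odometers; its orbits are the classes of equality up to finitely many digits
    in each coordinate, once the eventually constant sequences are removed.  The
    lamplighter moves along the [Z]-orbit of [z], the digits of [y] being the
    states of the lamps on this orbit; the lamps are labelled by natural numbers
    through a bijection that depends on [z], but moving [z] along its orbit
    changes only finitely many labels.  Hence the lamplighter has the same orbits
    as [Z^2]. *)

Set Implicit Arguments.
Unset Strict Implicit.
Unset Printing Implicit Defensive.

Import Order.TTheory GRing.Theory Num.Theory.

(** * Generated subgroups *)

(** The primes 5 and 13 are congruent to 1 modulo 4. Jacobi's count gives [p + 1] quaternions of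
    norm [p] congruent to 1 modulo 2 up to sign, hence 6 and 14 generators; classically the Cayley
    graphs of [A] and [B] are trees of these degrees, and [lattice65] is an irreducible lattice
    acting simply transitively on the vertices of their product. The proof rests on two facts: the
    exchange of generators, a finite check, and the triviality of the intersection of [A] and [B],
    obtained by comparing norms. Both [Z^2] and the lamplighter group are amenable, so orbit
    equivalent actions exist by Ornstein and Weiss; here they are explicit and their orbits coincide
    everywhere. The obstacle is that moving the lighter shifts all lamps at once, while an odometer
    changes finitely many digits; the labels absorb the shift. Measure equivalence is read off from
    the orbit relation, whose diagonal is a fundamental domain for both groups. *)

Section Words.
Local Open Scope group_scope.
Variables (G : groupType) (S : seq G).

Lemma eval_word_cat (w1 w2 : seq (bool * G)) :
  eval_word (w1 ++ w2) = eval_word w1 * eval_word w2.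
Proof. by elim: w1 => [|l w1 IH] /=; rewrite ?mul1g // IH mulgA. Qed.

Lemma letter_neg (l : bool * G) : letter (~~ l.1, l.2) = (letter l)^-1.
Proof. by case: l => [[] g]; rewrite /letter //= invgK. Qed.

Lemma eval_word_inv (w : seq (bool * G)) :
  word_over S w ->
  exists w', word_over S w' /\ eval_word w' = (eval_word w)^-1.
Proof.
elim: w => [_|l w IH /= /andP[lS /IH[w' [w'S e]]]].
  by exists [::]; rewrite /= invg1.
exists (w' ++ [:: (~~ l.1, l.2)]); split.
  by rewrite /word_over all_cat; apply/andP; split=> //=; rewrite lS.
by rewrite eval_word_cat /= mulg1 letter_neg e invgM.
Qed.

Lemma word_length1 : word_length S 1 = 0%N.
Proof.
rewrite /word_length; set A := (X in xget _ X).
have A0 : A 0%N by split=> //; exists [::].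
by case: (xgetPex 0%N (ex_intro _ _ A0)) => _ /(_ 0%N (proj1 A0)); case: xget.
Qed.

End Words.

(** The letter [l'] may depend on [x], so [f] need not be a homomorphism: it sends edges of one
    Cayley graph to edges of the other, hence paths to paths of the same length. *)
Lemma wl_le_edge_map (G H : groupType) (S : seq G) (T : seq H) (f : G -> H) :
  (forall x l, l.2 \in S ->
    exists2 l', l'.2 \in T & f (gmul x (letter l)) = gmul (f x) (letter l')) ->
  forall x y n, wl_le S (gmul (ginv x) y) n ->
    wl_le T (gmul (ginv (f x)) (f y)) n.
Proof.
move=> fE x y n [w [wS [ew wn]]]; elim: w x n wS ew wn => [|l w IH] x n /=.
  move=> _ e _; exists [::]; split=> //; split=> //=.
  by rewrite (_ : y = x) ?mulVg // -[LHS](mulVKg x) -e mulg1.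
move=> /andP[lS wS] ew; case: n => // n; rewrite ltnS => wn.
have [l' l'T fl] := fE x l lS.
have [|w' [w'T [ew' w'n]]] := IH (gmul x (letter l)) n wS _ wn.
  by rewrite invgM -mulgA -ew mulKg.
exists (l' :: w'); split; first exact/andP.
by split=> //=; rewrite ew' fl invgM -mulgA mulVKg.
Qed.

(** An isomorphism of Cayley graphs preserves word distances, whence the constants [K = 1] and
    [C = 0]. *)
Lemma quasi_isometric_of_edge_bij (G H : groupType) (S : seq G) (T : seq H)
    (f : G -> H) (g : H -> G) :
  generates S -> generates T -> cancel f g -> cancel g f ->
  (forall x l, l.2 \in S ->
    exists2 l', l'.2 \in T & f (gmul x (letter l)) = gmul (f x) (letter l')) ->
  (forall x l, l.2 \in T ->
    exists2 l', l'.2 \in S & g (gmul x (letter l)) = gmul (g x) (letter l')) ->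
  quasi_isometric G H.
Proof.
move=> gS gT fK gK fE gE; exists S, T; do 2!split=> //.
have dE x y : word_dist S x y = word_dist T (f x) (f y).
  suff e : wl_le S (gmul (ginv x) y) = wl_le T (gmul (ginv (f x)) (f y)).
    by rewrite /word_dist /word_length e.
  apply/funext => n; apply/propext; split; first exact: wl_le_edge_map.
  by move=> /(wl_le_edge_map gE); rewrite !fK.
exists f, 1%N, 0%N; split=> //; split=> [x y|z].
  by rewrite dE mul1n addn0; split.
by exists (g z); rewrite gK /word_dist mulVg word_length1.
Qed.

Section Generated.
Local Open Scope group_scope.
Variables (G : groupType) (S : seq G).

Definition in_gen : pred G :=
  fun g => `[< exists w, word_over S w /\ eval_word w = g >].

Record gen := Gen { gen_val : G; _ : in_gen gen_val }.

HB.instance Definition _ := [isSub for gen_val].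
HB.instance Definition _ := [Choice of gen by <:].

Lemma in_gen1 : in_gen 1. Proof. by apply/asboolP; exists [::]. Qed.

Lemma in_genM (x y : G) : in_gen x -> in_gen y -> in_gen (x * y).
Proof.
move=> /asboolP[w [wS <-]] /asboolP[w' [w'S <-]]; apply/asboolP.
by exists (w ++ w'); rewrite eval_word_cat /word_over all_cat; split=> //; apply/andP.
Qed.

Lemma in_genV (x : G) : in_gen x -> in_gen x^-1.
Proof. by move=> /asboolP[w [wS <-]]; apply/asboolP/eval_word_inv. Qed.

Lemma in_gen_sub (x : G) : x \in S -> in_gen x.
Proof.
move=> xS; apply/asboolP; exists [:: (false, x)].
by rewrite /word_over /= mulg1 xS.
Qed.

Lemma in_gen_ind (P : G -> Prop) : (forall s, s \in S -> s^-1 \in S) ->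
  P 1 -> (forall s g, s \in S -> in_gen g -> P g -> P (s * g)) ->
  forall g, in_gen g -> P g.
Proof.
move=> SV P1 PM g /asboolP[w [wS <-]]; elim: w wS => //= l w IH /andP[lS wS].
apply: PM; last exact: IH.
  by case: l lS => -[] s //= /SV.
by apply/asboolP; exists w.
Qed.

Definition gen_one := Gen in_gen1.
Definition gen_mul (x y : gen) := Gen (in_genM (valP x) (valP y)).
Definition gen_inv (x : gen) := Gen (in_genV (valP x)).

Lemma gen_mulA : associative gen_mul.
Proof. by move=> x y z; apply: val_inj; rewrite /= mulgA. Qed.
Lemma gen_mul1 : left_id gen_one gen_mul.
Proof. by move=> x; apply: val_inj; rewrite /= mul1g. Qed.
Lemma gen_1mul : right_id gen_one gen_mul.
Proof. by move=> x; apply: val_inj; rewrite /= mulg1. Qed.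
Lemma gen_mulV : left_inverse gen_one gen_inv gen_mul.
Proof. by move=> x; apply: val_inj; rewrite /= mulVg. Qed.
Lemma gen_Vmul : right_inverse gen_one gen_inv gen_mul.
Proof. by move=> x; apply: val_inj; rewrite /= mulgV. Qed.

HB.instance Definition _ :=
  isGroup.Build gen gen_mulA gen_mul1 gen_1mul gen_mulV gen_Vmul.

Definition gen_gens : seq gen := pmap insub S.

Lemma mem_gen_gens (x : gen) : (x \in gen_gens) = (val x \in S).
Proof.
rewrite mem_pmap_sub //.
Qed.

Lemma val_letter (l : bool * gen) : val (letter l) = letter (l.1, val l.2).
Proof. by case: l => -[]. Qed.

Lemma gen_generates : generates gen_gens.
Proof.
move=> x; have /asboolP[w [wS ew]] := valP x.
elim: w x wS ew => [x _ e|l w IH x /= /andP[lS wS] e].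
  by exists [::]; split=> //; apply: val_inj.
pose s := Gen (in_gen_sub lS).
have [|w' [w'S ew']] := IH (gmul (ginv (letter (l.1, s))) x) wS _.
  by rewrite /= -e val_letter /= -surjective_pairing mulKg.
exists ((l.1, s) :: w'); split; first by rewrite /word_over /= mem_gen_gens lS.
by rewrite /= ew' mulVKg.
Qed.

End Generated.

(** * Exact factorizations and products of Cayley graphs *)

Section Swap.
Local Open Scope group_scope.
Variables (G : groupType) (S T : seq G).
Hypothesis SV : forall s, s \in S -> s^-1 \in S.
Hypothesis TV : forall t, t \in T -> t^-1 \in T.
Hypothesis swap : forall s t, s \in S -> t \in T ->
  exists t' s', [/\ t' \in T, s' \in S & s * t = t' * s'].
(** The squares [s * t = t' * s'] are pasted along the word [b] into a strip. Its far side is again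
    a single generator, which is what later makes edges correspond to edges. *)
Lemma swap_gen_r s b : s \in S -> in_gen T b ->
  exists b' s', [/\ in_gen T b', s' \in S & s * b = b' * s'].
Proof.
move=> + bT; move: b bT s; apply: (in_gen_ind TV) => [s sS|t b tT bT IH s sS].
  by exists 1, s; rewrite mulg1 mul1g in_gen1.
have [t' [s' [t'T s'S e]]] := swap sS tT.
have [b' [s'' [b'T s''S e']]] := IH s' s'S.
exists (t' * b'), s''; split=> //; first by apply: in_genM => //; exact: in_gen_sub.
by rewrite mulgA e -mulgA e' mulgA.
Qed.

Lemma swap_gen_l s b : s \in S -> in_gen T b ->
  exists s' b', [/\ s' \in S, in_gen T b' & b * s = s' * b'].
Proof.
move=> sS bT; have [b' [s' [b'T s'S e]]] := swap_gen_r (SV sS) (in_genV bT).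
exists s'^-1, b'^-1; rewrite SV // in_genV //; split=> //.
by apply: invg_inj; rewrite !invgM !invgK.
Qed.

Lemma swap_sym t s : t \in T -> s \in S ->
  exists s' t', [/\ s' \in S, t' \in T & t * s = s' * t'].
Proof.
move=> tT sS; have [t' [s' [t'T s'S e]]] := swap (SV sS) (TV tT).
by exists s'^-1, t'^-1; rewrite SV // TV //; split=> //; apply: invg_inj;
  rewrite !invgM !invgK.
Qed.

End Swap.

Section ExactFactorization.
Local Open Scope group_scope.
Variables (G : groupType) (S T : seq G).
Hypothesis SV : forall s, s \in S -> s^-1 \in S.
Hypothesis TV : forall t, t \in T -> t^-1 \in T.
Hypothesis swap : forall s t, s \in S -> t \in T ->
  exists t' s', [/\ t' \in T, s' \in S & s * t = t' * s'].
Hypothesis triv : forall g, in_gen S g -> in_gen T g -> g = 1.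

Lemma swap_gens a b : in_gen S a -> in_gen T b ->
  exists b' a', [/\ in_gen T b', in_gen S a' & a * b = b' * a'].
Proof.
move=> aS; move: a aS b; apply: (in_gen_ind SV) => [b bT|s a sS aS IH b bT].
  by exists b, 1; rewrite mulg1 mul1g in_gen1.
have [b' [a' [b'T a'S e]]] := IH b bT.
have [b'' [s' [b''T s'S e']]] := swap_gen_r TV swap sS b'T.
exists b'', (s' * a'); split=> //; first by apply: in_genM => //; exact: in_gen_sub.
by rewrite -mulgA e mulgA e' mulgA.
Qed.

Lemma swap_gens' a b : in_gen S a -> in_gen T b ->
  exists a' b', [/\ in_gen S a', in_gen T b' & b * a = a' * b'].
Proof.
move=> aS bT; have [b' [a' [b'T a'S e]]] := swap_gens (in_genV aS) (in_genV bT).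
exists a'^-1, b'^-1; rewrite !in_genV //; split=> //.
by apply: invg_inj; rewrite !invgM !invgK.
Qed.

Lemma in_gen_catl g : in_gen S g -> in_gen (S ++ T) g.
Proof.
move: g; apply: (in_gen_ind SV) => [|s g sS _ IH]; first exact: in_gen1.
by apply: in_genM => //; rewrite in_gen_sub // mem_cat sS.
Qed.

Lemma in_gen_catr g : in_gen T g -> in_gen (S ++ T) g.
Proof.
move: g; apply: (in_gen_ind TV) => [|s g sT _ IH]; first exact: in_gen1.
by apply: in_genM => //; rewrite in_gen_sub // mem_cat sT orbT.
Qed.

Lemma gen_cat_factor g : in_gen (S ++ T) g ->
  exists a b, [/\ in_gen S a, in_gen T b & g = a * b].
Proof.
have STV s : s \in S ++ T -> s^-1 \in S ++ T.
  by rewrite !mem_cat => /orP[/SV->//|/TV->]; rewrite orbT.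
move: g; apply: (in_gen_ind STV) => [|s g].
  by exists 1, 1; rewrite mulg1 !in_gen1.
rewrite mem_cat => /orP[sS|sT] _ [a [b [aS bT ->]]].
  by exists (s * a), b; rewrite mulgA in_genM // in_gen_sub.
have [a' [b' [a'S b'T e]]] := swap_gens' aS (in_gen_sub sT).
by exists a', (b' * b); rewrite !mulgA -e in_genM.
Qed.

Lemma gen_cat_factor' g : in_gen (S ++ T) g ->
  exists b a, [/\ in_gen T b, in_gen S a & g = b * a].
Proof.
by move=> /gen_cat_factor[a [b [aS bT ->]]]; exact: swap_gens.
Qed.

(* The vertex [g = a b = b' a'] of the square complex has coordinates
   [a] and [b'] in the two factors. *)
Definition coords (g : gen (S ++ T)) (p : gen S * gen T) : Prop :=
  exists b a, [/\ in_gen T b, in_gen S a,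
    val g = val p.1 * b & val g = val p.2 * a].

Lemma coords_ex g : exists p, coords g p.
Proof.
have [a [b [aS bT e]]] := gen_cat_factor (valP g).
have [b' [a' [b'T a'S e']]] := gen_cat_factor' (valP g).
by exists (Gen aS, Gen b'T), b, a'.
Qed.

Lemma coords_ex' p : exists g, coords g p.
Proof.
(* [p.1] and [p.2] are two sides of a rectangle at the vertex [1]. Writing [p.1^-1 * p.2] as [b * a]
   gives [p.1 * b = p.2 * a^-1], the opposite corner. *)
have [b [a [bT aS e]]] := swap_gens (in_genV (valP p.1)) (valP p.2).
have gST : in_gen (S ++ T) (val p.1 * b).
  by apply: in_genM; [exact: in_gen_catl (valP p.1)|exact: in_gen_catr].
exists (Gen gST), b, a^-1; rewrite in_genV //; split=> //=.
by apply: (mulIg a); rewrite mulgVK -mulgA -e mulVKg.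
Qed.

Lemma mul_eq_div (x u y v : G) : x * u = y * v -> y^-1 * x = v * u^-1.
Proof. by move=> e; apply: (mulIg u); rewrite mulgVK -mulgA e mulKg. Qed.

Lemma eq_of_Vmul1 (x y : G) : y^-1 * x = 1 -> x = y.
Proof. by move=> e; apply: (mulgI y^-1); rewrite mulVg. Qed.

Lemma factor_uniq u v x y : in_gen S u -> in_gen S v -> in_gen T x ->
  in_gen T y -> u * x = v * y -> u = v.
Proof.
move=> uS vS xT yT /mul_eq_div e; apply: eq_of_Vmul1.
by apply: triv; [|rewrite e]; apply: in_genM => //; exact: in_genV.
Qed.

Lemma factor_uniq' u v x y : in_gen S u -> in_gen S v -> in_gen T x ->
  in_gen T y -> x * u = y * v -> x = y.
Proof.
move=> uS vS xT yT /mul_eq_div e; apply: eq_of_Vmul1.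
by apply: triv; [rewrite e|]; apply: in_genM => //; exact: in_genV.
Qed.

Lemma coords_uniq g p q : coords g p -> coords g q -> p = q.
Proof.
case: p q => [p1 p2] [q1 q2] [b [a [bT aS e1 e2]]] [b' [a' [bT' aS' e1' e2']]].
congr pair; apply: val_inj.
  by apply: (factor_uniq _ _ bT bT'); rewrite -?e1 -?e1' //; exact: valP.
by apply: (factor_uniq' aS aS'); rewrite -?e2 -?e2' //; exact: valP.
Qed.

(** The quotient [h^-1 * g] lies in [in_gen T] by the factorizations through [p.1] and in [in_gen S]
    by those through [p.2]. *)
Lemma coords_inj g h p : coords g p -> coords h p -> g = h.
Proof.
move=> [b [a [bT aS e1 e2]]] [b' [a' [bT' aS' e1' e2']]]; apply: val_inj.
apply: eq_of_Vmul1; apply: triv.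
  rewrite e2 e2' invgM -mulgA mulKg; apply: in_genM => //; exact: in_genV.
rewrite e1 e1' invgM -mulgA mulKg; apply: in_genM => //; exact: in_genV.
Qed.

Definition prod_gens : seq (gen S * gen T) :=
  [seq (s, 1) | s <- gen_gens S] ++ [seq (1, t) | t <- gen_gens T].

Lemma mem_prod_gens p : p \in prod_gens ->
  (val p.1 \in S /\ p.2 = 1) \/ (p.1 = 1 /\ val p.2 \in T).
Proof.
by rewrite mem_cat => /orP[] /mapP[x + ->]; rewrite mem_gen_gens; [left|right].
Qed.

Lemma mem_prod_gensl s : val s \in S -> (s, 1) \in prod_gens.
Proof.
by move=> sS; rewrite mem_cat; apply/orP; left; apply: map_f; rewrite mem_gen_gens.
Qed.

Lemma mem_prod_gensr t : val t \in T -> (1, t) \in prod_gens.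
Proof.
by move=> tT; rewrite mem_cat; apply/orP; right; apply: map_f; rewrite mem_gen_gens.
Qed.

Lemma inv_pairl (s : gen S) : (s, 1 : gen T)^-1 = (s^-1, 1).
Proof. by rewrite -[LHS]/(s^-1, 1^-1) invg1. Qed.

Lemma inv_pairr (t : gen T) : (1 : gen S, t)^-1 = (1, t^-1).
Proof. by rewrite -[LHS]/(1^-1, t^-1) invg1. Qed.

Lemma letter_pairl b (s : gen S) :
  letter (b, (s, 1 : gen T)) = (letter (b, s), 1).
Proof. by case: b => //; exact: inv_pairl. Qed.

Lemma letter_pairr b (t : gen T) :
  letter (b, (1 : gen S, t)) = (1, letter (b, t)).
Proof. by case: b => //; exact: inv_pairr. Qed.

Lemma prod_generates : generates prod_gens.
Proof.
move=> [a b].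
have [w [wS <-]] := gen_generates a; have [v [vT <-]] := gen_generates b.
exists ([seq (l.1, (l.2, 1)) | l <- w] ++ [seq (l.1, (1, l.2)) | l <- v]); split.
  rewrite /word_over all_cat !all_map; apply/andP; split.
    apply: sub_all wS => l /= lS.
    by apply: mem_prod_gensl; rewrite -mem_gen_gens.
  apply: sub_all vT => l /= lS.
  by apply: mem_prod_gensr; rewrite -mem_gen_gens.
rewrite eval_word_cat.
have -> : eval_word [seq (l.1, (l.2, 1)) | l <- w] = (eval_word w, 1 : gen T).
  by elim: w {wS} => //= l w ->; rewrite letter_pairl -[LHS]/(_ * _, 1 * 1) mulg1.
have -> : eval_word [seq (l.1, (1, l.2)) | l <- v] = (1 : gen S, eval_word v).
  by elim: v {vT} => //= l v ->; rewrite letter_pairr -[LHS]/(1 * 1, _ * _) mulg1.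
by rewrite -[LHS]/(_ * 1, 1 * _) mulg1 mul1g.
Qed.

Lemma letter_mem (H : groupType) (U : seq H) (l : bool * H) :
  (forall u, u \in U -> u^-1 \in U) -> l.2 \in U -> letter l \in U.
Proof. by case: l => -[] u UV //= /UV. Qed.

(** In [g = p.2 * a] the new generator is absorbed by [a], so the coordinate in [T] stays; in
    [g = p.1 * b] it slides through [b] and moves the coordinate in [S] by one generator. *)
Lemma coords_mul_l g p s s' b b' : coords g p -> in_gen T b -> val g = val p.1 * b ->
  val s \in S -> in_gen T b' -> b * val s = val s' * b' ->
  coords (g * s) (p * (s', 1)).
Proof.
move=> [_ [a [_ aS _ e2]]] bT e1 sS b'T e; exists b', (a * val s); split=> //=.
- by apply: in_genM => //; exact: in_gen_sub.
- by rewrite e1 -!mulgA e.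
by rewrite e2 mulg1 mulgA.
Qed.

Lemma coords_mul_r g p t t' a a' : coords g p -> in_gen S a -> val g = val p.2 * a ->
  val t \in T -> in_gen S a' -> a * val t = val t' * a' ->
  coords (g * t) (p * (1, t')).
Proof.
move=> [b [_ [bT _ e1 _]]] aS e2 tT a'S e; exists (b * val t), a'; split=> //=.
- by apply: in_genM => //; exact: in_gen_sub.
- by rewrite e1 mulg1 mulgA.
by rewrite e2 -!mulgA e.
Qed.

Lemma coords_edge g p u : coords g p -> val u \in S ++ T ->
  exists2 v, v \in prod_gens & coords (g * u) (p * v).
Proof.
move=> gp; have [b [a [bT aS e1 e2]]] := gp; rewrite mem_cat => /orP[uS|uT].
  have [s [b' [sS b'T e]]] := swap_gen_l SV TV swap uS bT.
  exists (Gen (in_gen_sub sS), 1); first exact: mem_prod_gensl.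
  exact: (coords_mul_l gp bT e1 uS b'T).
have [t [a' [tT a'S e]]] := swap_gen_l TV SV (swap_sym SV TV swap) uT aS.
exists (1, Gen (in_gen_sub tT)); first exact: mem_prod_gensr.
exact: (coords_mul_r gp aS e2 uT a'S).
Qed.

Lemma coords_edge' g p v : coords g p -> v \in prod_gens ->
  exists2 u, val u \in S ++ T & coords (g * u) (p * v).
Proof.
move=> gp; have [b [a [bT aS e1 e2]]] := gp.
case: v => [s t] /mem_prod_gens[] /= [].
  move=> sS ->.
  (* From [s^-1 * b = b' * s'] follows [b * s'^-1 = s * b'], so [s'^-1] is the generator that
     realizes the step [s] in the first coordinate. *)
  have [b' [s' [b'T s'S e]]] := swap_gen_r TV swap (SV sS) bT.
  have s'ST : s'^-1 \in S ++ T by rewrite mem_cat SV.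
  exists (Gen (in_gen_sub s'ST)) => //=.
  apply: (coords_mul_l gp bT e1 _ b'T) => /=; first exact: SV.
  by apply: (mulgI (val s)^-1); rewrite mulKg mulgA e mulgK.
move=> -> tT.
have [a' [t' [a'S t'T e]]] := swap_gen_r SV (swap_sym SV TV swap) (TV tT) aS.
have t'ST : t'^-1 \in S ++ T by rewrite mem_cat TV // orbT.
exists (Gen (in_gen_sub t'ST)) => //=.
apply: (coords_mul_r gp aS e2 _ a'S) => /=; first exact: TV.
by apply: (mulgI (val t)^-1); rewrite mulKg mulgA e mulgK.
Qed.

Lemma exact_factorization_quasi_isometric :
  quasi_isometric (gen S * gen T)%type (gen (S ++ T)).
Proof.
have [f fP] := choice coords_ex; have [h hP] := choice coords_ex'.
have STV s : s \in S ++ T -> s^-1 \in S ++ T.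
  by rewrite !mem_cat => /orP[/SV->//|/TV->]; rewrite orbT.
apply: (quasi_isometric_of_edge_bij (f := h) (g := f) prod_generates
          (@gen_generates _ _)).
- by move=> p; apply: coords_uniq (fP _) (hP p).
- by move=> x; apply: coords_inj (hP _) (fP x).
- move=> p l lP; have vP : letter l \in prod_gens.
    apply: letter_mem lP => -[s t] /mem_prod_gens[] /= [].
      by move=> sS ->; rewrite inv_pairl mem_prod_gensl //; exact: SV.
    by move=> -> tT; rewrite inv_pairr mem_prod_gensr //; exact: TV.
  have [u uST c] := coords_edge' (hP p) vP.
  by exists (false, u); [rewrite mem_gen_gens|apply: coords_inj (hP _) c].
move=> x l; rewrite mem_gen_gens => lST.
have vST : val (letter l) \in S ++ T.
  by rewrite val_letter; apply: letter_mem.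
have [v vP c] := coords_edge (fP x) vST.
by exists (false, v) => //; apply: coords_uniq (fP _) c.
Qed.

End ExactFactorization.

(** * Quaternions modulo scalars *)

(** Common start of the two negative results; [U] and [V] are the images of the factors. Finite
    index becomes a pigeonhole: among the first [(size s).+1] terms of a sequence, two lie in the
    same left coset of the image, and elements of the image split as [x * y]. *)
Lemma presentable_subgroups (G : groupType) : presentable_by_product G ->
  exists U V : G -> Prop,
  [/\ (forall x y, U x -> U y -> U (gmul x y)) /\ (forall x, U x -> U (ginv x)),
      forall x y, U x -> V y -> gmul x y = gmul y x,
      exists2 x, U x & x <> gone,
      exists2 y, V y & y <> gone &
      forall f : nat -> G, exists i j, [/\ (i < j)%N &
        exists x y, [/\ U x, V y & gmul (ginv (f i)) (f j) = gmul x y]]].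
Proof.
move=> [_ [G1 [G2 [phi [phiM [[s sP] [U_inf V_inf]]]]]]].
have phi1 : phi (gone, gone) = gone.
  by apply: (monoid.mulgI (phi (gone, gone))); rewrite -phiM /= !monoid.mulg1.
exists [set phi (x, gone) | x in [set: G1]]%classic,
       [set phi (gone, y) | y in [set: G2]]%classic; split.
- split=> [_ _ [x _ <-] [y _ <-]|_ [x _ <-]].
    by exists (gmul x y) => //; rewrite -phiM /= monoid.mulg1.
  exists (ginv x) => //; apply: (monoid.mulgI (phi (x, gone))).
  by rewrite -phiM /= monoid.mulg1 !monoid.mulgV.
- by move=> _ _ [x _ <-] [y _ <-]; rewrite -!phiM /= !monoid.mulg1 !monoid.mul1g.
- apply: contrapT => nU; apply: U_inf; apply: sub_finite_set (finite_set1 gone).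
  by move=> z zU /=; apply: contrapT => z1; apply: nU; exists z.
- apply: contrapT => nV; apply: V_inf; apply: sub_finite_set (finite_set1 gone).
  by move=> z zV /=; apply: contrapT => z1; apply: nV; exists z.
move=> f; have [t tP] := choice (fun i => sP (f i)).
have : ~~ uniq (mkseq t (size s).+1).
  apply/negP => /uniq_leq_size h; have /h : {subset mkseq t (size s).+1 <= s}.
    by move=> x /mapP[i _ ->]; case: (tP i).
  by rewrite size_mkseq ltnn.
move=> /(uniqPn gone)[i [j [ij]]]; rewrite size_mkseq => js.
rewrite !nth_mkseq //; last exact: ltn_trans js.
move=> tij; exists i, j; split=> //.
have [_ [p ep]] := tP i; have [_ [q eq]] := tP j.
exists (phi (gmul (ginv p.1) q.1, gone)), (phi (gone, gmul (ginv p.2) q.2)).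
split; [by exists (gmul (ginv p.1) q.1)|by exists (gmul (ginv p.2) q.2)|].
rewrite -phiM /= monoid.mulg1 monoid.mul1g ep eq -tij monoid.invgM -monoid.mulgA.
rewrite monoid.mulKg; apply: (monoid.mulgI (phi p)).
by rewrite monoid.mulVKg -phiM /= !monoid.mulVKg -surjective_pairing.
Qed.

Lemma prod_presentable (G H : groupType) :
  infinite_group G -> infinite_group H -> presentable_by_product (G * H)%type.
Proof.
move=> G_inf H_inf; split.
  move=> fin; apply: G_inf.
  apply: sub_finite_set (finite_image (fun p : G * H => p.1) fin).
  by move=> x _ /=; exists (x, gone).
exists G, H, id; split; first by move=> [x y] [x' y'].
split; first by exists [:: gone] => g; exists gone; rewrite inE; split=> //;
  exists g; rewrite monoid.mul1g.
split=> fin; [apply: G_inf|apply: H_inf].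
  apply: sub_finite_set (finite_image (fun p : G * H => p.1) fin).
  by move=> x _ /=; exists (x, gone) => //; exists x.
apply: sub_finite_set (finite_image (fun p : G * H => p.2) fin).
by move=> y _ /=; exists (gone, y) => //; exists y.
Qed.

Section Quaternions.
Local Open Scope ring_scope.

Definition qmul (R : comRingType) (p q : R * R * R * R) : R * R * R * R :=
  let: (a, b, c, d) := p in let: (a', b', c', d') := q in
  (a * a' - b * b' - c * c' - d * d', a * b' + b * a' + c * d' - d * c',
   a * c' + c * a' + d * b' - b * d', a * d' + d * a' + b * c' - c * b').

Definition qnorm (R : comRingType) (p : R * R * R * R) : R :=
  let: (a, b, c, d) := p in a ^+ 2 + b ^+ 2 + c ^+ 2 + d ^+ 2.

Definition qre (R : comRingType) (p : R * R * R * R) : R := p.1.1.1.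

Lemma qmulA (R : comRingType) : associative (@qmul R).
Proof.
move=> [[[a b] c] d] [[[a' b'] c'] d'] [[[a'' b''] c''] d''] /=.
by congr (_, _, _, _); ring.
Qed.

Lemma qnormM (R : comRingType) p q : qnorm (@qmul R p q) = qnorm p * qnorm q.
Proof. by case: p q => [[[a b] c] d] [[[a' b'] c'] d'] /=; ring. Qed.

(* Rodrigues' coordinates of the line spanned by a quaternion. *)
Definition gvec (q : rat * rat * rat * rat) : rat * rat * rat :=
  let: (a, b, c, d) := q in (b / a, c / a, d / a).

Definition qlift (v : rat * rat * rat) : rat * rat * rat * rat :=
  let: (x, y, z) := v in (1, x, y, z).

Definition gprod (u v : rat * rat * rat) := gvec (qmul (qlift u) (qlift v)).

Lemma gvec_qmul p q : qre p != 0 -> qre q != 0 ->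
  gprod (gvec p) (gvec q) = gvec (qmul p q).
Proof.
case: p q => [[[a b] c] d] [[[a' b'] c'] d'] /= a0 a'0.
rewrite /gprod /=.
have -> : 1 * 1 - b / a * (b' / a') - c / a * (c' / a') - d / a * (d' / a') =
  (a * a')^-1 * (a * a' - b * b' - c * c' - d * d') :> rat by field; apply/andP.
(* If the product has real part [0], both sides are the zero vector because [0^-1 = 0]. *)
have [->|D0] := eqVneq (a * a' - b * b' - c * c' - d * d') 0.
  by rewrite mulr0 !invr0 !mulr0.
by congr (_, _, _); field; rewrite D0 a0 a'0.
Qed.

Definition qrat (q : int * int * int * int) : rat * rat * rat * rat :=
  let: (a, b, c, d) := q in (a%:~R, b%:~R, c%:~R, d%:~R).

Lemma qratM p q : qrat (qmul p q) = qmul (qrat p) (qrat q).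
Proof.
case: p q => [[[a b] c] d] [[[a' b'] c'] d'] /=.
by rewrite !(rmorphB, rmorphD, rmorphM).
Qed.

(** Congruence to 1 modulo 2. It is multiplicative and makes the real part odd, hence nonzero; this
    excludes the half-turns, which have no Rodrigues coordinates. *)
Definition qodd (q : int * int * int * int) : Prop :=
  let: (a, b, c, d) := q in
  exists a' b' c' d', [/\ a = 2 * a' + 1, b = 2 * b', c = 2 * c' & d = 2 * d'].

Lemma qoddM p q : qodd p -> qodd q -> qodd (qmul p q).
Proof.
case: p q => [[[a b] c] d] [[[a' b'] c'] d'].
move=> [a1 [b1 [c1 [d1 [-> -> -> ->]]]]] [a2 [b2 [c2 [d2 [-> -> -> ->]]]]] /=.
exists (2 * a1 * a2 + a1 + a2 - 2 * b1 * b2 - 2 * c1 * c2 - 2 * d1 * d2).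
exists ((2 * a1 + 1) * b2 + b1 * (2 * a2 + 1) + 2 * c1 * d2 - 2 * d1 * c2).
exists ((2 * a1 + 1) * c2 + c1 * (2 * a2 + 1) + 2 * d1 * b2 - 2 * b1 * d2).
exists ((2 * a1 + 1) * d2 + d1 * (2 * a2 + 1) + 2 * b1 * c2 - 2 * c1 * b2).
by split; ring.
Qed.

Lemma qodd_re q : qodd q -> qre (qrat q) != 0.
Proof.
case: q => [[[a b] c] d] [a' [_ [_ [_ [-> _ _ _]]]]] /=.
by rewrite intr_eq0; apply/eqP; lia.
Qed.

Definition even_vec (u : rat * rat * rat) : bool :=
  `[< exists2 q, qodd q & u = gvec (qrat q) >].

Record gibbs := Gibbs { gibbs_val : rat * rat * rat; _ : even_vec gibbs_val }.

HB.instance Definition _ := [isSub for gibbs_val].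
HB.instance Definition _ := [Choice of gibbs by <:].

Lemma gibbs_of_proof q : qodd q -> even_vec (gvec (qrat q)).
Proof. by move=> oq; apply/asboolP; exists q. Qed.

Definition gibbs_of q (oq : qodd q) : gibbs := Gibbs (gibbs_of_proof oq).

Lemma gprod_lift p q : qodd p -> qodd q ->
  gprod (gvec (qrat p)) (gvec (qrat q)) = gvec (qrat (qmul p q)).
Proof. by move=> op oq; rewrite gvec_qmul ?qodd_re // qratM. Qed.

Lemma gibbs_mul_proof (u v : gibbs) : even_vec (gprod (val u) (val v)).
Proof.
have /asboolP[p op ->] := valP u; have /asboolP[q oq ->] := valP v.
by rewrite gprod_lift //; apply: gibbs_of_proof; exact: qoddM.
Qed.
Definition gibbs_mul u v := Gibbs (gibbs_mul_proof u v).

Lemma gibbs_one_proof : even_vec (0, 0, 0).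
Proof.
apply/asboolP; exists (1, 0, 0, 0); first by exists 0, 0, 0, 0.
by rewrite /gvec /= !mul0r.
Qed.
Definition gibbs_one := Gibbs gibbs_one_proof.

Definition qconj (q : int * int * int * int) :=
  let: (a, b, c, d) := q in (a, - b, - c, - d).

Definition gopp (u : rat * rat * rat) :=
  let: (x, y, z) := u in (- x, - y, - z).

Lemma gopp_lift q : gopp (gvec (qrat q)) = gvec (qrat (qconj q)).
Proof. by case: q => [[[a b] c] d] /=; rewrite !rmorphN /= !mulNr. Qed.

Lemma qodd_conj q : qodd q -> qodd (qconj q).
Proof.
case: q => [[[a b] c] d] [a' [b' [c' [d' [-> -> -> ->]]]]].
by exists a', (- b'), (- c'), (- d'); split=> //; ring.
Qed.

Lemma gibbs_inv_proof (u : gibbs) : even_vec (gopp (val u)).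
Proof.
have /asboolP[p op ->] := valP u.
by rewrite gopp_lift; apply: gibbs_of_proof; exact: qodd_conj.
Qed.
Definition gibbs_inv u := Gibbs (gibbs_inv_proof u).

(** Inherited from [qmulA] through integral lifts: their products have odd real part, so no
    denominator vanishes on the way. *)
Lemma gibbs_mulA : associative gibbs_mul.
Proof.
move=> u v w; apply: val_inj => /=.
have /asboolP[p op ->] := valP u; have /asboolP[q oq ->] := valP v.
have /asboolP[r or ->] := valP w.
rewrite !gprod_lift //; try exact: qoddM.
by rewrite qmulA.
Qed.

Lemma gibbs_mul1 : left_id gibbs_one gibbs_mul.
Proof.
move=> u; apply: val_inj; case: u => [[[x y] z] uP] /=.
rewrite /gprod /=; by congr (_, _, _); field.
Qed.

Lemma gibbs_1mul : right_id gibbs_one gibbs_mul.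
Proof.
move=> u; apply: val_inj; case: u => [[[x y] z] uP] /=.
rewrite /gprod /=; by congr (_, _, _); field.
Qed.

Lemma gibbs_mulV : left_inverse gibbs_one gibbs_inv gibbs_mul.
Proof.
move=> u; apply: val_inj; case: u => [[[x y] z] uP] /=; rewrite /gprod /=.
by congr (_, _, _); apply/eqP; rewrite mulf_eq0; apply/orP; left; apply/eqP; ring.
Qed.

Lemma gibbs_Vmul : right_inverse gibbs_one gibbs_inv gibbs_mul.
Proof.
move=> u; apply: val_inj; case: u => [[[x y] z] uP] /=; rewrite /gprod /=.
by congr (_, _, _); apply/eqP; rewrite mulf_eq0; apply/orP; left; apply/eqP; ring.
Qed.

HB.instance Definition _ :=
  isGroup.Build gibbs gibbs_mulA gibbs_mul1 gibbs_1mul gibbs_mulV gibbs_Vmul.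

End Quaternions.

(** * Quaternions of norm 5 and 13 *)

Section QuaternionLattice.
Local Open Scope ring_scope.
Notation Zquat := (int * int * int * int)%type.

Definition qoddb (q : Zquat) : bool :=
  let: (a, b, c, d) := q in
  [&& (2 %| (a - 1))%Z, (2 %| b)%Z, (2 %| c)%Z & (2 %| d)%Z].

Lemma qoddbP q : qoddb q -> qodd q.
Proof.
case: q => [[[a b] c] d].
move=> /and4P[/dvdzP[a' ea] /dvdzP[b' ->] /dvdzP[c' ->] /dvdzP[d' ->]].
by exists a', b', c', d'; split; lia.
Qed.

Definition gibbs_gens (l : seq Zquat) : seq gibbs :=
  pmap insub [seq gvec (qrat q) | q <- l].

Lemma mem_gibbs_gens l (u : gibbs) :
  reflect (exists2 q, q \in l & val u = gvec (qrat q)) (u \in gibbs_gens l).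
Proof. by rewrite mem_pmap_sub; exact: mapP. Qed.

Definition qpm (p q : Zquat) : bool :=
  let: (a, b, c, d) := q in (p == q) || (p == (- a, - b, - c, - d)).

Lemma gvec_qpm p q : qpm p q -> gvec (qrat p) = gvec (qrat q).
Proof.
case: q => [[[a b] c] d] /orP[/eqP->//|/eqP->] /=.
by rewrite !rmorphN /= !invrN !mulrNN.
Qed.

(** Up to sign, all integral quaternions of norm 5 congruent to 1 modulo 2: [5 = 1 + 4] leaves one
    even coordinate equal to [2] or [-2]. *)
Definition quats5 : seq Zquat :=
  [:: (1, 2, 0, 0); (1, -2, 0, 0); (1, 0, 2, 0); (1, 0, -2, 0);
      (1, 0, 0, 2); (1, 0, 0, -2)].

(** The same class in norm 13: [13 = 9 + 4] gives 6 quaternions and [13 = 1 + 4 + 4 + 4] gives 8. *)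
Definition quats13 : seq Zquat :=
  [:: (3, 2, 0, 0); (3, -2, 0, 0); (3, 0, 2, 0); (3, 0, -2, 0);
      (3, 0, 0, 2); (3, 0, 0, -2);
      (1, 2, 2, 2); (1, 2, 2, -2); (1, 2, -2, 2); (1, 2, -2, -2);
      (1, -2, 2, 2); (1, -2, 2, -2); (1, -2, -2, 2); (1, -2, -2, -2)].

Lemma quats5P q : q \in quats5 -> qodd q /\ qnorm q = 5.
Proof.
have : all (fun q => qoddb q && (qnorm q == 5)) quats5 by vm_compute.
by move=> /allP/[apply] /andP[/qoddbP ? /eqP].
Qed.

Lemma quats13P q : q \in quats13 -> qodd q /\ qnorm q = 13.
Proof.
have : all (fun q => qoddb q && (qnorm q == 13)) quats13 by vm_compute.
by move=> /allP/[apply] /andP[/qoddbP ? /eqP].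
Qed.

Lemma gibbs_gensV l : all (fun q => qconj q \in l) l ->
  forall u, u \in gibbs_gens l -> ginv u \in gibbs_gens l.
Proof.
move=> /allP lV u /mem_gibbs_gens[q ql e]; apply/mem_gibbs_gens.
by exists (qconj q); [exact: lV|rewrite -gopp_lift -e].
Qed.

Lemma gibbs_gens_swap u v : u \in gibbs_gens quats5 -> v \in gibbs_gens quats13 ->
  exists v' u', [/\ v' \in gibbs_gens quats13, u' \in gibbs_gens quats5 &
    gmul u v = gmul v' u'].
Proof.
have : all (fun p => all (fun q => has (fun q' => has (fun p' =>
    qpm (qmul p q) (qmul q' p')) quats5) quats13) quats13) quats5 by vm_compute.
move=> /allP sw /mem_gibbs_gens[p pl ep] /mem_gibbs_gens[q ql eq].
have /allP/(_ q ql)/hasP[q' q'l /hasP[p' p'l epq]] := sw p pl.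
have [op _] := quats5P pl; have [oq _] := quats13P ql.
have [op' _] := quats5P p'l; have [oq' _] := quats13P q'l.
exists (gibbs_of oq'), (gibbs_of op'); split.
- by apply/mem_gibbs_gens; exists q'.
- by apply/mem_gibbs_gens; exists p'.
apply: val_inj; rewrite /= ep eq !gprod_lift //; exact: gvec_qpm.
Qed.

(** An inverse letter is lifted to the conjugate quaternion, so lifts stay integral and every letter
    contributes a factor [N] to the norm. *)
Lemma in_gen_lift l (N : int) : (forall q, q \in l -> qodd q /\ qnorm q = N) ->
  forall u, in_gen (gibbs_gens l) u ->
  exists q n, [/\ qodd q, qnorm q = N ^+ n & val u = gvec (qrat q)].
Proof.
move=> lP u /asboolP[w [wl <-]]; elim: w wl => [_|[e v] w IH /= /andP[vl wl]].
  exists (1, 0, 0, 0), 0%N; split=> //; by exists 0, 0, 0, 0.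
have {}vl : v \in gibbs_gens l := vl.
have [q [n [oq Nq eq]]] := IH wl.
have [p [op Np ep]] : exists p,
    [/\ qodd p, qnorm p = N & val (letter (e, v)) = gvec (qrat p)].
  have /mem_gibbs_gens[p pl ep] := vl; have [op Np] := lP p pl.
  case: e; rewrite /letter /=; last by exists p.
  exists (qconj p); split; [exact: qodd_conj| |by rewrite ep gopp_lift].
  by case: p {pl ep op} Np => [[[a b] c] d] /= <-; rewrite !sqrrN.
exists (qmul p q), n.+1; split; first exact: qoddM.
  by rewrite qnormM Np Nq exprS.
by rewrite -[LHS]/(gprod (val (letter (e, v))) (val (eval_word w))) ep eq gprod_lift.
Qed.

(** Lifts [p] and [q] of norms [5^n] and [13^m] on one line satisfy [5^n * a'^2 = 13^m * a^2], where
    [a] and [a'] are their real parts. Comparing exponents of 5 yields [5^n <= a^2]; since [5^n] is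
    the norm of [p], its vector part vanishes. *)
Lemma gibbs_gens_triv u : in_gen (gibbs_gens quats5) u ->
  in_gen (gibbs_gens quats13) u -> u = gone.
Proof.
move=> /(in_gen_lift quats5P)[p [n [op Np ep]]].
move=> /(in_gen_lift quats13P)[q [m [oq Nq]]]; rewrite ep => epq.
have p0 := qodd_re op; have q0 := qodd_re oq.
apply: val_inj; rewrite ep.
case: p q op oq Np Nq ep epq p0 q0 => [[[a b] c] d] [[[a' b'] c'] d'] op oq Np Nq ep.
rewrite /= !intr_eq0 => -[eb ec ed] a0 a'0.
have cross x y : x%:~R / a%:~R = y%:~R / a'%:~R :> rat -> x * a' = y * a.
  move=> /eqP; rewrite eqr_div ?intr_eq0 // -!intrM eqr_int => /eqP ->.
  by [].
move/cross: eb => eb; move/cross: ec => ec; move/cross: ed => ed.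
have N_eq : 5 ^+ n * a' ^+ 2 = 13 ^+ m * a ^+ 2.
  by rewrite -Np -Nq /= !mulrDl -!exprMn eb ec ed (mulrC a).
(* With [v] the 5-adic valuation, [n + 2 v(a') = 2 v(a)]: so [n] is even and [v(a)] is at least
   [n / 2]. *)
have [k nk ka] : exists2 k, n = k.*2 & (5 ^ k %| `|a|%N)%N.
  have /(congr1 (fun x : int => logn 5 `|x|%N)) := N_eq.
  rewrite !abszM !abszX !lognM ?(expn_gt0, muln_gt0, absz_gt0, a0, a'0) //.
  rewrite !lognX (_ : logn 5 `|5| = 1%N) // (_ : logn 5 `|13| = 0%N) // => e5.
  exists n./2; first by lia.
  by rewrite pfactor_dvdn ?absz_gt0 //; lia.
have a_ge : 5 ^+ n <= a ^+ 2.
  have : (5 ^ k)%N%:Z <= `|a|%N%:Z by rewrite lez_nat dvdn_leq // absz_gt0.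
  rewrite -[(5 ^ k)%N%:Z]natz natrX natz abszE => ka'.
  by rewrite nk -muln2 exprM -[a ^+ 2]real_normK ?num_real // lerXn2r ?nnegrE
    ?exprn_ge0.
rewrite -Np /= in a_ge.
have b0 := sqr_ge0 b; have c0 := sqr_ge0 c; have d0 := sqr_ge0 d.
have /eqP : b ^+ 2 = 0 by lia.
have /eqP : c ^+ 2 = 0 by lia.
have /eqP : d ^+ 2 = 0 by lia.
by rewrite !sqrf_eq0 => /eqP-> /eqP-> /eqP->; rewrite !mul0r.
Qed.

(* Modulo its norm [N], [q ^+ 2] is [2 * Re q] times [q]. *)
Lemma gibbs_pow_neq1 (q : Zquat) (u : gibbs) (n : nat) (N : nat) :
  qodd q -> val u = gvec (qrat q) -> qnorm q = N%:Z -> prime N ->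
  ~~ (N%:Z %| 2 * qre q)%Z ->
  (let: (a, b, c, d) := q in ~~ [&& (N%:Z %| b)%Z, (N%:Z %| c)%Z & (N%:Z %| d)%Z]) ->
  (u ^+ n.+1)%g <> gone.
Proof.
move=> oq eu Nq prN; case: q oq eu Nq => [[[a b] c] d] oq eu Nq Na Nbcd.
rewrite /= in Nq Na.
(* Invariant: the power is represented by a quaternion congruent to [x * q] modulo [N], with [N] not
   dividing [x]. It cannot be scalar, because [N] does not divide the vector part of [q]. *)
have [x [A [B [C [D [[Nx oQ eQ] [kA [kB [kC [kD [eA eB eC eD]]]]]]]]]]] :
   exists x A B C D, [/\ ~~ (N%:Z %| x)%Z, qodd (A, B, C, D) &
   val (u ^+ n.+1)%g = gvec (qrat (A, B, C, D))] /\
   exists kA kB kC kD, [/\ A = x * a + N%:Z * kA, B = x * b + N%:Z * kB,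
     C = x * c + N%:Z * kC & D = x * d + N%:Z * kD].
  elim: n => [|n [x [A [B [C [D [[Nx oQ eQ] [kA [kB [kC [kD [eA eB eC eD]]]]]]]]]]]].
    exists 1, a, b, c, d; split.
      by split=> //; rewrite dvdz1; case: (N) prN => [|[|?]].
    by exists 0, 0, 0, 0; split; ring.
  have := qoddM oq oQ; have := gprod_lift oq oQ; rewrite /=.
  set A' := _ - d * D; set B' := _ - d * C; set C' := _ - b * D; set D' := _ - c * B.
  move=> eQ' oQ'; exists (2 * a * x), A', B', C', D'; split.
    split=> //; last first.
      by rewrite -[gibbs_val u]/(val u) eu -[gibbs_val _]/(val (u ^+ n.+1)%g) eQ.
    move: Na Nx; rewrite !dvdzE /= !abszM !Euclid_dvdM //.
    by rewrite !negb_or => /andP[-> ->] ->.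
  (* The term [- x] comes from [a^2 - b^2 - c^2 - d^2 = 2 * a^2 - N]. *)
  exists (a * kA - b * kB - c * kC - d * kD - x), (a * kB + b * kA + c * kD - d * kC),
    (a * kC + c * kA + d * kB - b * kD), (a * kD + d * kA + b * kC - c * kB).
  rewrite /A' /B' /C' /D' eA eB eC eD -Nq; split; ring.
have A0 := qodd_re oQ; rewrite /= in A0.
move=> /(congr1 val); rewrite eQ => -[].
have zero (X Y k : int) : X = x * Y + N%:Z * k -> X%:~R / A%:~R = 0 :> rat ->
    (N%:Z %| Y)%Z.
  move=> eX /eqP; rewrite mulf_eq0 invr_eq0 (negPf A0) orbF intr_eq0 => /eqP X0.
  have : (N%:Z %| x * Y)%Z by apply/dvdzP; exists (- k); apply/eqP;
    rewrite mulNr -addr_eq0 (mulrC k) -eX X0.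
  by move: Nx; rewrite !dvdzE abszM Euclid_dvdM //= => /negPf->.
move=> /(zero _ _ _ eB) Nb /(zero _ _ _ eC) Nc /(zero _ _ _ eD) Nd.
by rewrite Nb Nc Nd in Nbcd.
Qed.

End QuaternionLattice.

Lemma val_gen_pow (G : groupType) (S : seq G) (x : gen S) n :
  val (x ^+ n)%g = (val x ^+ n)%g.
Proof. by elim: n => // n IH; rewrite !monoid.expgS /= -IH. Qed.

Lemma pow_inj (G : groupType) (g : G) :
  (forall n, (g ^+ n.+1)%g <> 1%g) -> injective (fun n => (g ^+ n)%g).
Proof.
move=> gP i j; wlog ij : i j / (i <= j)%N.
  by move=> h; case/orP: (leq_total i j) => [/h|/h h' /esym/h' ->].
move=> e; apply/eqP; rewrite eqn_leq ij leqNgt; apply/negP => lt_ij.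
have := gP (j - i.+1)%N; apply; rewrite -subSn // subSS.
by rewrite monoid.expgnFr // e monoid.mulgV.
Qed.

Lemma infinite_group_of_pow (G : groupType) (g : G) :
  (forall n, (g ^+ n.+1)%g <> 1%g) -> infinite_group G.
Proof.
move=> /pow_inj gI fin; apply: infinite_nat.
apply: (finite_preimage (f := fun n => (g ^+ n)%g) (B := setT) _ fin).
by move=> i j _ _; exact: gI.
Qed.

Lemma infinite_gen (G : groupType) (S : seq G) (g : G) : in_gen S g ->
  (forall n, (g ^+ n.+1)%g <> 1%g) -> infinite_group (gen S).
Proof.
move=> gS gP; apply: (infinite_group_of_pow (g := Gen gS)) => n /(congr1 val).
by rewrite val_gen_pow; exact: gP.
Qed.

Notation lattice5 := (gen (gibbs_gens quats5)).
Notation lattice13 := (gen (gibbs_gens quats13)).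
Notation lattice65 := (gen (gibbs_gens quats5 ++ gibbs_gens quats13)).

(** * Axes of rotations and the result on quasi-isometry *)

Section Parallel.
Local Open Scope ring_scope.

(** Vanishing of the cross product. The zero vector is parallel to everything, so transitivity needs
    a nonzero middle vector. *)
Definition par (u v : rat * rat * rat) : Prop :=
  let: (x, y, z) := u in let: (x', y', z') := v in
  [/\ x * y' = y * x', y * z' = z * y' & z * x' = x * z'].

Lemma par_sym u v : par u v -> par v u.
Proof.
by case: u v => [[x y] z] [[x' y'] z'] [e1 e2 e3]; split;
  rewrite mulrC -?e1 -?e2 -?e3 mulrC.
Qed.

Lemma par_trans u v w : v != (0, 0, 0) -> par u v -> par v w -> par u w.
Proof.
case: u v w => [[x y] z] [[x' y'] z'] [[x'' y''] z''] v0 [e1 e2 e3] [f1 f2 f3].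
have [k [k0]] : exists k, k != 0 /\ [\/ k = x', k = y' | k = z'].
  have [ex|] := eqVneq x' 0; last by move=> h; exists x'; split=> //; constructor.
  have [ey|] := eqVneq y' 0; last by move=> h; exists y'; split=> //; constructor.
  have [ez|] := eqVneq z' 0; last by move=> h; exists z'; split=> //; constructor.
  by rewrite ex ey ez eqxx in v0.
have cancel (a b : rat) : k * a = k * b -> a = b by move=> /(mulfI k0).
have scale c (a b : rat) : a = b -> c * a = c * b by move=> ->.
(* With monomials as unknowns, each goal times the nonzero coordinate [k] of [v] is a linear
   combination of these products. *)
have [e1x e1y e1z] := And3 (scale x'' _ _ e1) (scale y'' _ _ e1) (scale z'' _ _ e1).
have [e2x e2y e2z] := And3 (scale x'' _ _ e2) (scale y'' _ _ e2) (scale z'' _ _ e2).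
have [e3x e3y e3z] := And3 (scale x'' _ _ e3) (scale y'' _ _ e3) (scale z'' _ _ e3).
have [f1x f1y f1z] := And3 (scale x _ _ f1) (scale y _ _ f1) (scale z _ _ f1).
have [f2x f2y f2z] := And3 (scale x _ _ f2) (scale y _ _ f2) (scale z _ _ f2).
have [f3x f3y f3z] := And3 (scale x _ _ f3) (scale y _ _ f3) (scale z _ _ f3).
by case=> ek; split; apply: cancel; rewrite ek; lra.
Qed.

Lemma gprod_denom (u v : gibbs) : qre (qmul (qlift (val u)) (qlift (val v))) != 0.
Proof.
have /asboolP[p op ->] := valP u; have /asboolP[q oq ->] := valP v.
have := qodd_re op; have := qodd_re oq; have := qodd_re (qoddM op oq).
rewrite qratM; case: p q {op oq} => [[[a b] c] d] [[[a' b'] c'] d'] /= D0 a0 a'0.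
suff -> : 1 * 1 - b%:~R / a%:~R * (b'%:~R / a'%:~R)
    - c%:~R / a%:~R * (c'%:~R / a'%:~R) - d%:~R / a%:~R * (d'%:~R / a'%:~R) =
  (a%:~R * a'%:~R)^-1 * (a%:~R * a'%:~R - b%:~R * b'%:~R - c%:~R * c'%:~R
    - d%:~R * d'%:~R) :> rat.
  by rewrite mulf_neq0 // invr_eq0 mulf_neq0.
by field; apply/andP.
Qed.

(** The products in both orders have the same denominator [1 - u.v], nonzero by [gprod_denom], and
    their numerators differ by twice the cross product. *)
Lemma comm_par (u v : gibbs) : gmul u v = gmul v u -> par (val u) (val v).
Proof.
move=> /(congr1 val) /=; have := gprod_denom u v.
case: u v => [[[x y] z] up] [[[x' y'] z'] vp] /=.
rewrite /gprod /= => D0 [].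
rewrite (_ : 1 * 1 - x' * x - y' * y - z' * z = 1 * 1 - x * x' - y * y' - z * z');
  last by ring.
have cancel (a b : rat) : a / (1 * 1 - x * x' - y * y' - z * z') =
  b / (1 * 1 - x * x' - y * y' - z * z') -> a = b.
  by move=> /(mulIf _)->//; rewrite invr_eq0.
by move=> /cancel e1 /cancel e2 /cancel e3; split; lra.
Qed.

(** Two vectors parallel to [w] have zero cross product, so their product is a scalar multiple of
    their sum. *)
Lemma par_mul (u v : gibbs) w : w != (0, 0, 0) ->
  par (val u) w -> par (val v) w -> par (val (gmul u v)) w.
Proof.
move=> w0 pu pv; have puv := par_trans w0 pu (par_sym pv).
case: u v w {w0} pu pv puv => [[[x y] z] up] [[[x' y'] z'] vp] [[x'' y''] z''].
move=> /= [e1 e2 e3] [f1 f2 f3] [g1 g2 g3].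
have h1 : y * z' - z * y' = 0 by rewrite g2 subrr.
have h2 : z * x' - x * z' = 0 by rewrite g3 subrr.
have h3 : x * y' - y * x' = 0 by rewrite g1 subrr.
rewrite /gprod /=; set k := _^-1.
rewrite -![_ + _ * _ - _ * _]addrA h1 h2 h3 !addr0 !mul1r !mulr1.
by split; rewrite !(mulrAC _ k) ?[_ * k * _]mulrAC !mulrDl ?e1 ?e2 ?e3 ?f1 ?f2 ?f3.
Qed.


Lemma gibbs_gens5V u : u \in gibbs_gens quats5 -> ginv u \in gibbs_gens quats5.
Proof. by apply: gibbs_gensV; vm_compute. Qed.

Lemma gibbs_gens13V u : u \in gibbs_gens quats13 -> ginv u \in gibbs_gens quats13.
Proof. by apply: gibbs_gensV; vm_compute. Qed.

Lemma lattice_quasi_isometric :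
  quasi_isometric (lattice5 * lattice13)%type lattice65.
Proof.
apply: exact_factorization_quasi_isometric.
- exact: gibbs_gens5V.
- exact: gibbs_gens13V.
- exact: gibbs_gens_swap.
exact: gibbs_gens_triv.
Qed.

Lemma quats5_infinite_order q : q \in quats5 -> exists2 u : gibbs,
  u \in gibbs_gens quats5 & val u = gvec (qrat q) /\ forall n, (u ^+ n.+1)%g <> 1%g.
Proof.
move=> ql; have [oq Nq] := quats5P ql.
exists (gibbs_of oq); first by apply/mem_gibbs_gens; exists q.
split=> // n; apply: (gibbs_pow_neq1 oq (N := 5)) => //.
  by have : all (fun q => ~~ (5%:Z %| 2 * qre q)%Z) quats5 by [];
    move=> /allP/(_ _ ql).
have : all (fun q : int * int * int * int => let: (a, b, c, d) := q in
  ~~ [&& (5%:Z %| b)%Z, (5%:Z %| c)%Z & (5%:Z %| d)%Z]) quats5 by [].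
by move=> /allP/(_ _ ql).
Qed.

Lemma quats13_infinite_order q : q \in quats13 -> exists2 u : gibbs,
  u \in gibbs_gens quats13 & val u = gvec (qrat q) /\ forall n, (u ^+ n.+1)%g <> 1%g.
Proof.
move=> ql; have [oq Nq] := quats13P ql.
exists (gibbs_of oq); first by apply/mem_gibbs_gens; exists q.
split=> // n; apply: (gibbs_pow_neq1 oq (N := 13)) => //.
  by have : all (fun q => ~~ (13%:Z %| 2 * qre q)%Z) quats13 by [];
    move=> /allP/(_ _ ql).
have : all (fun q : int * int * int * int => let: (a, b, c, d) := q in
  ~~ [&& (13%:Z %| b)%Z, (13%:Z %| c)%Z & (13%:Z %| d)%Z]) quats13 by [].
by move=> /allP/(_ _ ql).
Qed.

End Parallel.

Lemma infinite_lattice5 : infinite_group lattice5.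
Proof.
have [|u uS [_ uP]] := @quats5_infinite_order (1, 2, 0, 0)%R; first by [].
exact: infinite_gen (in_gen_sub uS) uP.
Qed.

Lemma infinite_lattice13 : infinite_group lattice13.
Proof.
have [|u uS [_ uP]] := @quats13_infinite_order (3, 2, 0, 0)%R; first by [].
exact: infinite_gen (in_gen_sub uS) uP.
Qed.

Lemma infinite_lattice65 : infinite_group lattice65.
Proof.
have [|u uS [_ uP]] := @quats5_infinite_order (1, 2, 0, 0)%R; first by [].
by apply: infinite_gen (in_gen_sub _) uP; rewrite mem_cat uS.
Qed.

(* Commuting elements are rotations about a common axis, so the two commuting
   subgroups rotate about one axis [w]; finite index puts a power of every
   element on that axis. *)
Lemma lattice65_not_presentable : ~ presentable_by_product lattice65.
Proof.
move=> /presentable_subgroups[U [V [_ UV [x Ux x1] [y Vy y1] fin]]].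
have val0 (z : lattice65) : z <> gone -> val (val z) != (0, 0, 0)%R.
  by move=> z1; apply/eqP => e; apply: z1; do 2!apply: val_inj.
have commP (a b : lattice65) : gmul a b = gmul b a -> par (val (val a)) (val (val b)).
  by move=> /(congr1 val); exact: comm_par.
have w0 := val0 _ x1; set w := val (val x) in w0.
have Vw v : V v -> par (val (val v)) w by move=> Vv; apply/par_sym/commP/UV.
(* The nontrivial [y] commutes with all of [U] and lies on the axis [w], which carries the axis over
   to [U]. *)
have Uw u : U u -> par (val (val u)) w.
  by move=> Uu; apply: (par_trans (val0 _ y1)); [exact/commP/UV|exact: Vw].
have axis (g : gibbs) : g \in gibbs_gens quats5 -> (forall n, (g ^+ n.+1)%g <> 1%g) ->
    par (val g) w.
  move=> gS gP.
  have gST : in_gen (gibbs_gens quats5 ++ gibbs_gens quats13) g.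
    by apply: in_gen_sub; rewrite mem_cat gS.
  have [i [j [ij [u [v [Uu Vv e]]]]]] := fin (fun n => (Gen gST ^+ n)%g).
  have {}e : (Gen gST ^+ (j - i.+1).+1)%g = gmul u v.
    rewrite -subSn // subSS -e; apply: (monoid.mulgI (Gen gST ^+ i)%g).
    by rewrite monoid.mulVKg -monoid.expgnDr subnKC // ltnW.
  have {}e := congr1 val e; rewrite val_gen_pow /= in e.
  have gn0 : val (g ^+ (j - i.+1).+1)%g != (0, 0, 0)%R.
    by apply/eqP => e0; apply: (gP (j - i.+1)%N); exact: val_inj.
  apply: (par_trans gn0).
    by apply: comm_par; rewrite -monoid.expgS -monoid.expgSr.
  by rewrite e; apply: par_mul => //; [exact: Uw|exact: Vw].
(* The quaternions [1 + 2i] and [1 + 2j] have different axes. *)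
have [|a aS [ea aP]] := @quats5_infinite_order (1, 2, 0, 0)%R; first by [].
have [|b bS [eb bP]] := @quats5_infinite_order (1, 0, 2, 0)%R; first by [].
have := par_trans w0 (axis a aS aP) (par_sym (axis b bS bP)).
by rewrite ea eb => -[/eqP].
Qed.

(** * The lamplighter group and Z^2 *)

Definition zz := (int * int)%type.
HB.instance Definition _ := Choice.on zz.

Section ZZ.
Local Open Scope ring_scope.
Definition zz_mul (p q : zz) : zz := (p.1 + q.1, p.2 + q.2).
Definition zz_inv (p : zz) : zz := (- p.1, - p.2).
Lemma zz_mulA : associative zz_mul.
Proof. by move=> p q r; rewrite /zz_mul /= !addrA. Qed.
Lemma zz_mul1 : left_id (0, 0) zz_mul.
Proof. by case=> a b; rewrite /zz_mul /= !add0r. Qed.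
Lemma zz_1mul : right_id (0, 0) zz_mul.
Proof. by case=> a b; rewrite /zz_mul /= !addr0. Qed.
Lemma zz_mulV : left_inverse (0, 0) zz_inv zz_mul.
Proof. by case=> a b; rewrite /zz_mul /= !addNr. Qed.
Lemma zz_Vmul : right_inverse (0, 0) zz_inv zz_mul.
Proof. by case=> a b; rewrite /zz_mul /= !subrr. Qed.
HB.instance Definition _ :=
  isGroup.Build zz zz_mulA zz_mul1 zz_1mul zz_mulV zz_Vmul.
End ZZ.

(* [(f, k)] moves the lighter by [k] and switches the lamps at the positions
   [f] relative to the lighter. *)
Definition lamp := ({fset int} * int)%type.
HB.instance Definition _ := Choice.on lamp.

Section Lamp.
Local Open Scope ring_scope.
Local Open Scope fset_scope.

Definition lamp_shift (k : int) (f : {fset int}) : {fset int} :=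
  [fset (j - k)%R | j in f].

Lemma in_lamp_shift k f j : (j \in lamp_shift k f) = ((j + k)%R \in f).
Proof.
apply/imfsetP/idP => [[i /= fi ->]|fjk]; first by rewrite subrK.
by exists (j + k)%R; rewrite ?addrK.
Qed.

Definition lamp_xor (f g : {fset int}) : {fset int} := (f `\` g) `|` (g `\` f).

Lemma in_lamp_xor f g j : (j \in lamp_xor f g) = (j \in f) (+) (j \in g).
Proof. by rewrite !inE; case: (j \in f); case: (j \in g). Qed.

Definition lamp_mul (p q : lamp) : lamp :=
  (lamp_xor p.1 (lamp_shift p.2 q.1), (p.2 + q.2)%R).
Definition lamp_one : lamp := (fset0, 0%R).
Definition lamp_set (f : {fset int}) : lamp := (f, 0%R).
Definition lamp_move (k : int) : lamp := (fset0, k).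
Definition lamp_inv (p : lamp) : lamp := (lamp_shift (- p.2) p.1, (- p.2)%R).

Definition in_lamp := (in_lamp_xor, in_lamp_shift, in_fset0).

Lemma lamp_mulA : associative lamp_mul.
Proof.
move=> p q r; congr pair; last by rewrite /= addrA.
by apply/fsetP => j; rewrite !in_lamp /= -addrA addbA.
Qed.
Lemma lamp_mul1 : left_id lamp_one lamp_mul.
Proof.
case=> f k; congr pair; last by rewrite /= add0r.
by apply/fsetP => j; rewrite !in_lamp /= addr0.
Qed.
Lemma lamp_1mul : right_id lamp_one lamp_mul.
Proof.
case=> f k; congr pair; last by rewrite /= addr0.
by apply/fsetP => j; rewrite !in_lamp addbF.
Qed.
Lemma lamp_mulV : left_inverse lamp_one lamp_inv lamp_mul.
Proof.
case=> f k; congr pair; last by rewrite /= addNr.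
by apply/fsetP => j; rewrite !in_lamp addbb.
Qed.
Lemma lamp_Vmul : right_inverse lamp_one lamp_inv lamp_mul.
Proof.
case=> f k; congr pair; last by rewrite /= subrr.
by apply/fsetP => j; rewrite !in_lamp /= addrK addbb.
Qed.
HB.instance Definition _ :=
  isGroup.Build lamp lamp_mulA lamp_mul1 lamp_1mul lamp_mulV lamp_Vmul.

Lemma lampV (p : lamp) : ginv p = lamp_inv p. Proof. by []. Qed.

(** Otherwise the finite set would contain an infinite arithmetic progression of step [k]. *)
Lemma shift_invariant_fset0 (f : {fset int}) (k : int) : k != 0%R ->
  lamp_shift k f = f -> f = fset0.
Proof.
move=> k0 fk; apply: contrapT => /eqP/fset0Pn[i fi].
have fik (n : nat) : (i + k * n%:Z)%R \in f.
  elim: n => [|n IH]; first by rewrite mulr0 addr0.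
  by rewrite -addn1 PoszD mulrDr mulr1 addrA -in_lamp_shift fk.
have fin : finite_set [set` f] by exact: finite_fset.
apply: infinite_nat.
apply: sub_finite_set (finite_preimage (f := fun n : nat => (i + k * n%:Z)%R) _ fin).
  by move=> n _; exact: fik.
by move=> n m _ _ /addrI/(mulfI k0)[].
Qed.

Lemma lamp_commute0 (f : {fset int}) (p : lamp) : p.2 != 0%R ->
  gmul (lamp_set f) p = gmul p (lamp_set f) -> f = fset0.
Proof.
case: p => g k /= k0 /(congr1 fst) /= e; apply: (shift_invariant_fset0 k0).
apply/fsetP => j; have := congr1 (fun h : {fset int} => j \in h) e.
by rewrite !in_lamp /= addr0; do 3!case: (_ \in _).
Qed.

Lemma lamp_mul_snd (p q : lamp) : (gmul p q).2 = (p.2 + q.2)%R.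
Proof. by []. Qed.

(** An element without translation that commutes with a translating one is trivial ([com0]). This
    forces translating elements into both [U] and [V] and makes [U] abelian; then the quotient of
    two lamp configurations in one coset commutes with a translating element of [U], so it is
    trivial. *)
Lemma lamp_not_presentable : ~ presentable_by_product lamp.
Proof.
move=> /presentable_subgroups[U [V [[UM UI] UV [x Ux x1] [y Vy y1] fin]]].
have com0 (p q : lamp) : q.2 != 0%R -> gmul p q = gmul q p -> p.2 = 0%R -> p = gone.
  by case: p => f k q0 e /= k0; rewrite k0 in e *; rewrite (lamp_commute0 q0 e).
pose tt := lamp_move 1.
have tpow n : ((tt ^+ n)%g).2 = n%:Z.
  by elim: n => // n IH; rewrite monoid.expgS lamp_mul_snd IH -intS.
(* A nonzero translation is a product [u * v], so [u] or [v] translates. If only [v] does, the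
   nontrivial [x] in [U] commutes with it and must translate. *)
have [u0 Uu0 u00] : exists2 u, U u & u.2 != 0%R.
  have [i [j [ij [u [v [Uu Vv /(congr1 snd)]]]]]] := fin (fun n => (tt ^+ n)%g).
  rewrite !lamp_mul_snd lampV /= !tpow => e.
  have [u0|] := eqVneq u.2 0%R; last by exists u.
  exists x => //; apply/eqP => x0; apply: x1; apply: (com0 _ v) => //; last exact: UV.
  by apply/eqP; move: e; rewrite u0 => e v0; rewrite v0 in e; lia.
have [v0 Vv0 v00] : exists2 v, V v & v.2 != 0%R.
  exists y => //; apply/eqP => y0; apply: y1.
  by apply: (com0 _ u0) => //; apply/esym/UV.
(* Commutators in [U] have zero translation and commute with [v0]. *)
have U_comm u u' : U u -> U u' -> gmul u u' = gmul u' u.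
  move=> Uu Uu'; apply: (monoid.mulgI (ginv (gmul u' u))).
  rewrite monoid.mulVg; apply: (com0 _ v0) => //.
    by apply: UV => //; apply: (UM _ _); [apply: (UI _)|]; exact: (UM _ _).
  by rewrite !lamp_mul_snd lampV /= addrC [(u'.2 + _)%R]addrC subrr.
pose d (n : nat) := lamp_set [fset n%:Z].
have [i [j [ij [u [v [Uu Vv e]]]]]] := fin d.
have e0 : gmul (ginv (d i)) (d j) = gone.
  apply: (com0 _ u0) => //; rewrite e.
  by rewrite -monoid.mulgA -(UV _ _ Uu0 Vv) !monoid.mulgA (U_comm _ _ Uu Uu0).
have : d i = d j by apply: (monoid.mulgI (ginv (d i))); rewrite monoid.mulVg e0.
by move=> [/fset1_inj []] eij; rewrite eij ltnn in ij.
Qed.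

Lemma lamp_infinite : infinite_group lamp.
Proof.
apply: (infinite_group_of_pow (g := lamp_move 1)) => n.
move=> /(congr1 snd); suff -> : ((lamp_move 1 ^+ n.+1)%g).2 = n.+1%:Z by [].
by elim: n => // n IH; rewrite monoid.expgS lamp_mul_snd IH -intS.
Qed.

Lemma lamp_finitely_generated : finitely_generated lamp.
Proof.
pose t := lamp_move 1; pose d := lamp_set [fset 0%R].
exists [:: t; d]; suff gP p : in_gen [:: t; d] p by move=> p; exact/asboolP/gP.
have tG : in_gen [:: t; d] t by apply: in_gen_sub; rewrite inE eqxx.
have dG : in_gen [:: t; d] d by apply: in_gen_sub; rewrite !inE eqxx orbT.
have tkG (k : int) : in_gen [:: t; d] (lamp_move k).
  have tnG (n : nat) : in_gen [:: t; d] (lamp_move n%:Z).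
    elim: n => [|n IH]; first exact: in_gen1.
    rewrite [X in in_gen _ X](_ : _ = gmul t (lamp_move n%:Z)); first exact: in_genM.
    congr pair.
    by apply/fsetP => j; rewrite !in_lamp.
  case: k => // n.
  rewrite [X in in_gen _ X](_ : _ = ginv (lamp_move n.+1%:Z)); first exact: in_genV.
  congr pair.
  by apply/fsetP => j; rewrite !in_lamp.
have sG (j : int) : in_gen [:: t; d] (lamp_set [fset j]).
  rewrite [X in in_gen _ X](_ : _ = gmul (gmul (lamp_move (- j)%R) d) (lamp_move j)).
    by do 2?[apply: in_genM].
  congr pair; last by rewrite /= addr0 addNr.
  by apply/fsetP => i; rewrite !in_lamp /= !inE addbF subr_eq0.
case: p => f k.
rewrite [X in in_gen _ X](_ : _ = gmul (lamp_set f) (lamp_move k)); last first.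
  congr pair; last by rewrite /= add0r.
  by apply/fsetP => i; rewrite !in_lamp /= addbF.
apply: in_genM => //.
elim/fset1U_rect: f => [|j f jf IH]; first exact: tkG.
rewrite [X in in_gen _ X](_ : _ = gmul (lamp_set [fset j]) (lamp_set f));
  first exact: in_genM.
congr pair; apply/fsetP => i; rewrite !in_lamp /= addr0 !inE.
by case: eqVneq => [->|//] /=; rewrite (negPf jf).
Qed.

End Lamp.

Local Open Scope ring_scope.

Lemma zz_infinite : infinite_group zz.
Proof.
apply: (infinite_group_of_pow (g := (1, 0)%R : zz)) => n.
move=> /(congr1 fst); suff -> : ((((1, 0)%R : zz) ^+ n.+1)%g).1 = n.+1%:Z by [].
by elim: n => // n IH; rewrite monoid.expgS /= IH -intS.
Qed.

Lemma zz_finitely_generated : finitely_generated zz.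
Proof.
pose a : zz := (1, 0)%R; pose b : zz := (0, 1)%R.
exists [:: a; b]; suff gP p : in_gen [:: a; b] p by move=> p; exact/asboolP/gP.
have aG : in_gen [:: a; b] a by apply: in_gen_sub; rewrite inE eqxx.
have bG : in_gen [:: a; b] b by apply: in_gen_sub; rewrite !inE eqxx orbT.
have powG (c : zz) : in_gen [:: a; b] c -> forall k : int,
    in_gen [:: a; b] (c.1 * k, c.2 * k)%R.
  move=> cG; have cnG (n : nat) : in_gen [:: a; b] (c.1 * n%:Z, c.2 * n%:Z)%R.
    elim: n => [|n IH]; first by rewrite !mulr0; exact: in_gen1.
    rewrite [X in in_gen _ X](_ : _ = gmul c (c.1 * n%:Z, c.2 * n%:Z)%R);
      first exact: in_genM.
    by congr pair; rewrite -addn1 PoszD mulrDr mulr1 addrC.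
  case=> // n; rewrite NegzE !mulrN.
  by have := in_genV (cnG n.+1).
case: p => k l; have := in_genM (powG a aG k) (powG b bG l).
by rewrite [X in in_gen _ X](_ : _ = (k, l)) //; congr pair;
  rewrite /= !mul1r !mul0r ?addr0 ?add0r.
Qed.

Lemma zz_presentable : presentable_by_product zz.
Proof.
split; first exact: zz_infinite.
exists zz, zz, (fun p => gmul p.1 p.2); split.
  move=> [[a b] [c d]] [[a' b'] [c' d']]; congr pair => /=; ring.
split.
  exists [:: gone] => g; exists gone; rewrite inE; split=> //.
  by exists (g, gone); rewrite /= monoid.mulg1 monoid.mul1g.
by split=> fin; apply: zz_infinite; apply: sub_finite_set fin => g _;
  exists g => //=; rewrite ?monoid.mulg1 ?monoid.mul1g.
Qed.

(** * The odometer *)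

Section BinarySequences.

(** Infinitely many zeros stop every carry and infinitely many ones stop every borrow, so adding any
    integer changes finitely many digits. *)
Record bseq := BSeq {
  bs :> nat -> bool;
  bs_inf : forall (n : nat) (b : bool), exists2 i, (n <= i)%N & bs i = b }.

HB.instance Definition _ := gen_eqMixin bseq.
HB.instance Definition _ := gen_choiceMixin bseq.

Lemma odd_inf (n : nat) (b : bool) : exists2 i, (n <= i)%N & odd i = b.
Proof.
have [<-|nb] := eqVneq (odd n) b; first by exists n.
by exists n.+1 => //=; case: (odd n) b nb => -[].
Qed.

HB.instance Definition _ := isPointed.Build bseq (BSeq odd_inf).

Lemma bseq_ext (s t : bseq) : (forall i, s i = t i) -> s = t.
Proof.
case: s t => s sP [t tP] /= /funext st; case: t / st tP => tP.
by congr BSeq; exact: Prop_irrelevance.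
Qed.

(** Least significant digit first: [s] is a 2-adic integer and [bval s n] its residue modulo
    [2^n]. *)
Fixpoint bval (s : nat -> bool) (n : nat) : nat :=
  if n is m.+1 then (bval s m + s m * 2 ^ m)%N else 0%N.

Lemma bval_lt s n : (bval s n < 2 ^ n)%N.
Proof. by elim: n => //= n IH; rewrite expnS; case: (s n); lia. Qed.

Lemma bval_eqP (s t : nat -> bool) n :
  (bval s n = bval t n) <-> (forall i, (i < n)%N -> s i = t i).
Proof.
elim: n => [|n [IH1 IH2]]; first by split.
have := bval_lt s n; have := bval_lt t n; rewrite /= => ltn ltm; split.
  move=> e; have [eb en] : bval s n = bval t n /\ s n = t n.
    by move: e; case: (s n); case: (t n); lia.
  move=> i; rewrite ltnS leq_eqVlt => /orP[/eqP->//|]; exact: IH1.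
by move=> st; rewrite IH2 ?st // => i ilt; apply: st; exact: ltnW.
Qed.

Lemma bval_large (s : bseq) (c : nat) : exists n, (c <= bval s n)%N.
Proof.
elim: c => [|c [n cn]]; first by exists 0%N.
have [i ni si] := bs_inf s n true; exists i.+1; rewrite /= si mul1n.
have : (bval s n <= bval s i)%N.
  elim: i ni {si} => [|i IH]; first by rewrite leqn0 => /eqP->.
  by rewrite leq_eqVlt => /orP[/eqP->//|/IH /leq_trans]; apply; exact: leq_addr.
by have := expn_gt0 2 i; lia.
Qed.

(** Adding [i] to the first [n] digits causes no carry or borrow beyond them; the step by [i] stays
    in the dyadic block of length [2^n] on the orbit line. *)
Definition in_block (s : nat -> bool) (n : nat) (i : int) : Prop :=
  0 <= (bval s n)%:Z + i < (2 ^ n)%N%:Z.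

Lemma in_block_mono s n m i : (n <= m)%N -> in_block s n i -> in_block s m i.
Proof.
move=> /subnK<-; elim: (m - n)%N => // d IH /IH; rewrite /in_block /= addSn /= expnS.
by case: (s _); lia.
Qed.

Lemma bval_negb s n : (bval (fun i => ~~ s i) n + bval s n).+1 = (2 ^ n)%N.
Proof. by elim: n => //= n; rewrite expnS; case: (s n) => /=; lia. Qed.

Lemma in_block_ex (s : bseq) (i : int) : exists n, in_block s n i.
Proof.
have negb_inf n b : exists2 i, (n <= i)%N & ~~ s i = b.
  by have [j nj sj] := bs_inf s n (~~ b); exists j; rewrite // sj negbK.
have [n nP] := bval_large s `|i|; have [m mP] := bval_large (BSeq negb_inf) `|i|.
have b0 : in_block s (maxn n m) 0.
  by rewrite /in_block; have := bval_lt s (maxn n m); lia.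
have [i0|i0] := leP 0 i.
  by exists m; rewrite /in_block; have := bval_negb s m; move: mP => /=; lia.
by exists n; rewrite /in_block; have := bval_lt s n; lia.
Qed.

Definition zbit (i : nat) (x : int) : bool :=
  (2 ^ i)%N%:Z <= (x %% (2 ^ i.+1)%N%:Z)%Z.

Definition odo_raw (k : int) (s : nat -> bool) : nat -> bool :=
  fun i => zbit i ((bval s i.+1)%:Z + k).

Lemma modz_small_eq (x d r q : int) : x = q * d + r -> 0 <= r < d -> (x %% d)%Z = r.
Proof.
move=> -> rd; rewrite modzMDl modz_small // ger0_norm //; lia.
Qed.

Lemma zbitP i x :
  (x %% (2 ^ i.+1)%N%:Z)%Z = (x %% (2 ^ i)%N%:Z)%Z + (zbit i x * 2 ^ i)%N%:Z.
Proof.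
rewrite /zbit; set p := (2 ^ i)%N%:Z; set r := (x %% (2 ^ i.+1)%N%:Z)%Z.
have p0 : 0 < p by rewrite /p ltz_nat expn_gt0.
have pS : (2 ^ i.+1)%N%:Z = 2 * p by rewrite /p expnS PoszM.
have ex : x = (x %/ (2 * p))%Z * (2 * p) + r by rewrite /r pS -divz_eq.
have r0 : 0 <= r by apply: modz_ge0; rewrite pS; lia.
have r1 : r < 2 * p by rewrite /r pS; apply: ltz_pmod; lia.
case: (leP p r) => rp; rewrite (mul1n, mul0n).
  rewrite (@modz_small_eq x p (r - p) ((x %/ (2 * p))%Z * 2 + 1));
    [rewrite /p; lia|..].
    by rewrite [LHS]ex; ring.
  by lia.
rewrite (@modz_small_eq x p r ((x %/ (2 * p))%Z * 2)) ?addr0 //.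
  by rewrite [LHS]ex; ring.
by lia.
Qed.

(** This identifies [odo_raw k] with addition of [k] in the 2-adic integers; the group law and the
    action on prefixes become arithmetic modulo [2^n]. *)
Lemma bval_odo k s n :
  (bval (odo_raw k s) n)%:Z = (((bval s n)%:Z + k) %% (2 ^ n)%N%:Z)%Z.
Proof.
elim: n => [|n IH]; first by rewrite /= modz1.
rewrite [LHS]PoszD IH /odo_raw zbitP; congr (_ + _).
rewrite -[in LHS](modzMDl (s n : nat)%:Z); congr (_ %% _)%Z.
by rewrite /= PoszD PoszM; ring.
Qed.

Lemma odo_block k s n : in_block s n k ->
  (bval (odo_raw k s) n)%:Z = (bval s n)%:Z + k.
Proof.
move=> b; rewrite bval_odo modz_small // ger0_norm //.
Qed.

Lemma odo_tail k s n : in_block s n k -> forall i, (n <= i)%N -> odo_raw k s i = s i.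
Proof.
move=> b i ni.
have := odo_block (in_block_mono ni b).
have := odo_block (in_block_mono (leqW ni) b); rewrite /=.
have := expn_gt0 2 i.
by case: (odo_raw k s i); case: (s i); lia.
Qed.

Lemma inf_tail (s : bseq) (t : nat -> bool) N :
  (forall i, (N <= i)%N -> t i = s i) ->
  forall n b, exists2 i, (n <= i)%N & t i = b.
Proof.
move=> ts n b; have [i ni si] := bs_inf s (maxn n N) b.
rewrite geq_max in ni; have [ni' Ni] := andP ni.
by exists i; rewrite // ts.
Qed.

Lemma odo_inf k (s : bseq) n b : exists2 i, (n <= i)%N & odo_raw k s i = b.
Proof. by have [N /odo_tail/inf_tail] := in_block_ex s k; apply. Qed.

Definition odo (k : int) (s : bseq) : bseq := BSeq (odo_inf k s).

Lemma odo0 s : odo 0 s = s.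
Proof.
apply: bseq_ext => i; have : bval (odo 0 s) i.+1 = bval s i.+1.
  have : in_block s i.+1 0 by rewrite /in_block; have := bval_lt s i.+1; lia.
  by move=> /odo_block /=; rewrite addr0 => -[].
by move=> /bval_eqP; exact.
Qed.

Lemma odoD k l s : odo k (odo l s) = odo (k + l) s.
Proof.
apply: bseq_ext => i; have : bval (odo k (odo l s)) i.+1 = bval (odo (k + l) s) i.+1.
  apply: (can_inj absz_nat).
  by rewrite [LHS]bval_odo [in LHS]bval_odo [RHS]bval_odo modzDml -addrA (addrC l).
by move=> /bval_eqP; exact.
Qed.

Lemma odo_free k s : odo k s = s -> k = 0.
Proof.
move=> e; have [n /odo_block b] := in_block_ex s k.
by move: b; rewrite -[odo_raw k s]/(bs (odo k s)) e; lia.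
Qed.

Lemma odo_tail_ex k (s : bseq) : exists N, forall i, (N <= i)%N -> odo k s i = s i.
Proof. by have [n /odo_tail nP] := in_block_ex s k; exists n. Qed.

(** The difference of the [N]-digit values is the required translation: equal tails keep it constant
    at all higher levels. *)
Lemma tail_odo (s t : bseq) N : (forall i, (N <= i)%N -> t i = s i) ->
  exists k, odo k s = t.
Proof.
move=> ts; pose k := (bval t N)%:Z - (bval s N)%:Z; exists k.
have kE m : (N <= m)%N -> (bval s m)%:Z + k = (bval t m)%:Z.
  rewrite /k => /subnK<-; elim: (m - N)%N => [|d IH]; first by rewrite addrC subrK.
  by rewrite addSn /= ts ?leq_addl //; lia.
apply: bseq_ext => i; have : bval (odo k s) (maxn N i.+1) = bval t (maxn N i.+1).
  have e := kE _ (leq_maxl N i.+1).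
  have b : in_block s (maxn N i.+1) k.
    by rewrite /in_block e; have := bval_lt t (maxn N i.+1); lia.
  by have := odo_block b; rewrite e /= => -[].
by move=> /bval_eqP; apply; exact: leq_maxr.
Qed.

Lemma odo_agree k (s t : bseq) n :
  (forall i, (i < n)%N -> s i = t i) <->
  (forall i, (i < n)%N -> odo k s i = odo k t i).
Proof.
suff h l (u v : bseq) : (forall i, (i < n)%N -> u i = v i) ->
    forall i, (i < n)%N -> odo l u i = odo l v i.
  by split; [exact: h|move=> /(h (- k)); rewrite !odoD !addNr !odo0].
move=> /bval_eqP e; apply/bval_eqP; apply: (can_inj absz_nat).
by rewrite !bval_odo e.
Qed.

End BinarySequences.

(** * The lamplighter action *)

Arguments odo : simpl never.

Section Labels.

(* [bval s n] is the position of the base point in its dyadic block of length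
   [2 ^ n] on the orbit line; the block of level [m.+1] is that of level [m]
   plus a new half, whose points receive the labels [2 ^ m .. 2 ^ m.+1 - 1]. *)
Definition kap (s : nat -> bool) (l : nat) : int :=
  if l is 0%N then 0 else let m := trunc_log 2 l in
  (l - 2 ^ m)%N%:Z - (bval s m)%:Z + (if s m then - (2 ^ m)%N%:Z else (2 ^ m)%N%:Z).

Lemma kapE s m r : (r < 2 ^ m)%N -> kap s (2 ^ m + r) =
  r%:Z - (bval s m)%:Z + (if s m then - (2 ^ m)%N%:Z else (2 ^ m)%N%:Z).
Proof.
move=> rm; have m0 := expn_gt0 2 m; rewrite /= in m0.
rewrite /kap; case E : (2 ^ m + r)%N => [|l]; first by lia.
have -> : trunc_log 2 l.+1 = m.
  by apply: trunc_log_eq => //; rewrite -E leq_addr expnS; lia.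
by rewrite -E addKn.
Qed.

Lemma label_cases l : l = 0%N \/ exists m r, (r < 2 ^ m)%N /\ l = (2 ^ m + r)%N.
Proof.
case: l => [|l]; [by left|right].
have /andP[lo hi] := trunc_log_bounds (isT : (1 < 2)%N) (isT : (0 < l.+1)%N).
by exists (trunc_log 2 l.+1), (l.+1 - 2 ^ trunc_log 2 l.+1)%N;
  rewrite subnKC // expnS in hi *; lia.
Qed.

(** Labels of level [m] fall in the half added to the block of level [m], so labels of different
    levels never meet. *)
Lemma kap_new s m r : (r < 2 ^ m)%N ->
  ~ in_block s m (kap s (2 ^ m + r)) /\ in_block s m.+1 (kap s (2 ^ m + r)).
Proof.
move=> rm; rewrite kapE // /in_block /= expnS.
by case: (s m); split; lia.
Qed.

Lemma in_block0 s n : in_block s n 0.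
Proof. by rewrite /in_block; have := bval_lt s n; lia. Qed.

Lemma kap_inj s : injective (kap s).
Proof.
move=> l l' e.
case: (label_cases l) e => [->|[m [r [rm ->]]]];
  case: (label_cases l') => [->|[m' [r' [rm' ->]]]] //.
- by move=> e; have [[]] := kap_new s rm'; rewrite -e; exact: in_block0.
- by move=> e; have [[]] := kap_new s rm; rewrite e; exact: in_block0.
wlog mm' : m m' r r' rm rm' / (m <= m')%N.
  by move=> h; case/orP: (leq_total m m') => [/h|/h h' /esym /h' ->]; auto.
move: mm'; rewrite leq_eqVlt => /orP[/eqP em|lt_m]; last first.
  move=> e; have [[]] := kap_new s rm'; rewrite -e.
  by apply: in_block_mono lt_m _; have [] := kap_new s rm.
by case: m' / em rm' => rm'; rewrite !kapE //; case: (s m); lia.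
Qed.

Lemma kap_surj_block s n i : in_block s n i -> exists l, kap s l = i.
Proof.
elim: n => [|n IH]; first by rewrite /in_block /= => b; exists 0%N; rewrite /kap; lia.
have [/IH//|nb b] := pselect (in_block s n i).
exists (2 ^ n + (if s n then `|((bval s n)%:Z + i + (2 ^ n)%N%:Z)%R|
                 else `|((bval s n)%:Z + i - (2 ^ n)%N%:Z)%R|))%N.
move: nb b; rewrite /in_block /= expnS => nb b.
by rewrite kapE; case: (s n) nb b => nb b; lia.
Qed.

Lemma kap_surj (s : bseq) i : exists l, kap s l = i.
Proof. by have [n /kap_surj_block] := in_block_ex s i. Qed.

Definition lam (s : bseq) (i : int) : nat := projT1 (cid (kap_surj s i)).

Lemma kapK (s : bseq) i : kap s (lam s i) = i.
Proof. by rewrite /lam; case: cid. Qed.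

Lemma lamK (s : bseq) l : lam s (kap s l) = l.
Proof. by apply: (@kap_inj s); rewrite kapK. Qed.

(** If [k] does not leave the block of level [n], both base points have the same blocks from that
    level on, and labels from [2^n] on name the same points of the line. For this reason labels
    follow dyadic blocks, not the distance to the base point. *)
Lemma kap_odo (s : bseq) k : exists N, forall l, (N <= l)%N ->
  kap (odo k s) l + k = kap s l.
Proof.
have [n nP] := in_block_ex s k; exists (2 ^ n)%N => l nl.
case: (label_cases l) nl => [->|[m [r [rm ->]]] nl].
  by rewrite leqn0 expn_eq0.
have nm : (n <= m)%N.
  rewrite leqNgt; apply/negP => mn.
  have : (2 ^ m.+1 <= 2 ^ n)%N by rewrite leq_exp2l.
  by rewrite expnS; lia.
rewrite !kapE // (odo_block (in_block_mono nm nP)).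
by rewrite [odo k s m](odo_tail nP nm); ring.
Qed.

Lemma kap_agree s t l : (forall i, (i <= l)%N -> s i = t i) -> kap s l = kap t l.
Proof.
case: (label_cases l) => [->//|[m [r [rm ->]]]] st; rewrite !kapE //.
have ml : (m <= 2 ^ m + r)%N by apply: leq_trans (leq_addr _ _); exact/ltnW/ltn_expl.
rewrite st // (_ : bval s m = bval t m) //.
by apply/bval_eqP => i im; apply: st; exact: leq_trans (ltnW im) ml.
Qed.

End Labels.

Section LampAction.
Local Open Scope fset_scope.
Local Open Scope ring_scope.

(** Label [l] at the new base point names the position [kap (odo p.2 z) l], which seen from [z] is
    [p.2] further. The old digit is read there under its old label and switched if the position is
    in [p.1]. *)
Definition lamp_fib_raw (p : lamp) (z : bseq) (y : nat -> bool) : nat -> bool :=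
  fun l => y (lam z (kap (odo p.2 z) l + p.2)) (+)
    (kap (odo p.2 z) l \in (p.1 : {fset int})).

Lemma fset_labels_bounded (z : bseq) (f : {fset int}) :
  exists N, forall l, (N <= l)%N -> kap z l \notin f.
Proof.
elim/fset1U_rect: f => [|j f _ [N NP]]; first by exists 0%N.
exists (maxn N (lam z j).+1) => l; rewrite geq_max => /andP[Nl jl].
rewrite !inE negb_or NP // andbT; apply/eqP => e.
by rewrite -e lamK ltnn in jl.
Qed.

Lemma lamp_fib_tail p z : exists N, forall l, (N <= l)%N ->
  lam z (kap (odo p.2 z) l + p.2) = l /\ kap (odo p.2 z) l \notin (p.1 : {fset int}).
Proof.
have [N NP] := kap_odo z p.2; have [M MP] := fset_labels_bounded (odo p.2 z) p.1.
exists (maxn N M) => l; rewrite geq_max => /andP[Nl Ml].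
by rewrite NP // lamK MP.
Qed.

Lemma lamp_fib_raw_tail p z (y : nat -> bool) : exists N, forall l, (N <= l)%N ->
  lamp_fib_raw p z y l = y l.
Proof.
have [N NP] := lamp_fib_tail p z; exists N => l /NP[e /negPf f].
by rewrite /lamp_fib_raw e f addbF.
Qed.

Lemma lamp_fib_inf p z (y : bseq) n b :
  exists2 i, (n <= i)%N & lamp_fib_raw p z y i = b.
Proof. by have [N /inf_tail] := lamp_fib_raw_tail p z y; apply. Qed.

Definition lamp_fib p z y : bseq := BSeq (@lamp_fib_inf p z y).

Lemma lamp_fibE (f : {fset int}) (k : int) z y l : lamp_fib (f, k) z y l =
  y (lam z (kap (odo k z) l + k)) (+) (kap (odo k z) l \in f).
Proof. by []. Qed.

Definition lamp_act (p : lamp) (x : bseq * bseq) : bseq * bseq :=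
  (odo p.2 x.1, lamp_fib p x.1 x.2).

Lemma lamp_act1 x : lamp_act gone x = x.
Proof.
case: x => z y; rewrite -[LHS]/(odo 0 z, lamp_fib (fset0, 0) z y) odo0.
congr pair; apply: bseq_ext => l.
by rewrite lamp_fibE odo0 addr0 lamK in_fset0 addbF.
Qed.

Lemma lamp_actM p q x : lamp_act (gmul p q) x = lamp_act p (lamp_act q x).
Proof.
case: p q x => [f k] [g l] [z y].
rewrite -[LHS]/(odo (k + l) z, lamp_fib (lamp_xor f (lamp_shift k g), k + l) z y).
rewrite -[RHS]/(odo k (odo l z), lamp_fib (f, k) (odo l z) (lamp_fib (g, l) z y)).
rewrite odoD; congr pair; apply: bseq_ext => i.
rewrite !lamp_fibE odoD kapK in_lamp_xor in_lamp_shift -addrA.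
by rewrite -addbA (addbC (_ \in g)).
Qed.

Lemma lamp_act_free : free_action lamp_act.
Proof.
move=> [f k] [z y] [/odo_free /= k0 e2]; rewrite k0 in e2 *.
congr pair; apply/fsetP => j; rewrite in_fset0.
have := congr1 (fun s : bseq => s (lam z j)) e2.
by rewrite lamp_fibE odo0 addr0 lamK kapK; case: (y _); case: (_ \in _).
Qed.

Definition zz_act (p : zz) (x : bseq * bseq) : bseq * bseq :=
  (odo p.1 x.1, odo p.2 x.2).

Lemma zz_act1 x : zz_act gone x = x.
Proof. by case: x => z y; rewrite -[LHS]/(zz_act (0, 0) (z, y)) /zz_act /= !odo0. Qed.

Lemma zz_actM p q x : zz_act (gmul p q) x = zz_act p (zz_act q x).
Proof. by case: x => z y; rewrite /zz_act /= !odoD. Qed.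

Lemma zz_act_free : free_action zz_act.
Proof. by move=> [k l] [z y] [/odo_free/= -> /odo_free/= ->]. Qed.

Lemma lamp_act_zz p x : exists q, zz_act q x = lamp_act p x.
Proof.
case: x => z y; have [N NP] := lamp_fib_raw_tail p z y.
have [l yl] := @tail_odo y (lamp_fib p z y) N NP.
by exists (p.2, l); rewrite /zz_act /= yl.
Qed.

(** The lamps to switch are those where the relabelled [y] disagrees with [odo l y]. Relabelling and
    odometer both change finitely many digits, so these lamps form a finite set. *)
Lemma zz_act_lamp q x : exists p, lamp_act p x = zz_act q x.
Proof.
case: x q => z y [k l]; have [N NP] := odo_tail_ex l y.
have [M MP] := kap_odo z k.
pose flip i := y (lam z (kap (odo k z) i + k)) (+) odo l y i.
pose f := [fset kap (odo k z) i | i in iota 0 (maxn N M) & flip i].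
exists (f, k); rewrite /zz_act /lamp_act /=; congr pair; apply: bseq_ext => i.
rewrite lamp_fibE.
have -> : (kap (odo k z) i \in f) = flip i.
  apply/imfsetP/idP => [[j /=]|fi].
    by rewrite !inE => /andP[_ fj] /kap_inj->.
  exists i => //=; rewrite !inE fi andbT mem_iota /= add0n ltnNge.
  apply/negP; rewrite geq_max => /andP[Ni Mi].
  by move: fi; rewrite /flip MP // lamK NP // addbb.
by rewrite /flip addbA addbb.
Qed.

End LampAction.

(** * The coin-tossing measure *)

Local Open Scope classical_set_scope.

Section Cylinders.

Definition agree n (s t : nat -> bool) : Prop := forall i, (i < n)%N -> s i = t i.

Definition cyl n (s : bseq) : set bseq := [set t : bseq | agree n t s].

Definition cyls : set (set bseq) :=
  [set A | A = set0 \/ exists n s, A = cyl n s].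

HB.instance Definition _ := @isMeasurable.Build (sigma_display cyls) bseq
  <<s cyls >> (@sigma_algebra0 _ setT cyls) (@sigma_algebraC _ cyls)
  (@sigma_algebra_bigcup _ setT cyls).

Lemma measurable_cyl n s : measurable (cyl n s).
Proof. by apply: sub_sigma_algebra; right; exists n, s. Qed.

Lemma measurable_level n (A : set bseq) :
  (forall s t : bseq, agree n s t -> A s -> A t) -> measurable A.
Proof.
move=> An.
have -> : A = \bigcup_v [set s : bseq | bval s n = v /\ A s].
  by apply/seteqP; split=> [s As|s [v _ [_ As]]] //; exists (bval s n).
apply: bigcupT_measurable => v.
have [[s [sv As]]|no] := pselect (exists s : bseq, bval s n = v /\ A s); last first.
  rewrite (_ : [set _ | _] = set0) //.
  by apply/seteqP; split=> // s sP; apply: no; exists s.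
rewrite (_ : [set _ | _] = cyl n s); first exact: measurable_cyl.
apply/seteqP; split=> [t [tv At]|t /= ts].
  by rewrite /cyl /=; apply/bval_eqP; rewrite tv sv.
split; first by rewrite -sv; apply/bval_eqP.
by apply: An As => i /ts.
Qed.

Lemma measurable_bit i b : measurable [set s : bseq | s i = b].
Proof. by apply: (@measurable_level i.+1) => s t st <-; rewrite st. Qed.

Lemma measurable_fun_bseq d (T : measurableType d) (f : T -> bseq) :
  (forall i, measurable [set x | f x i]) -> measurable_fun setT f.
Proof.
move=> mf; apply: (measurability cyls) => // _ [B [->|[n [s ->]]] <-].
  by rewrite preimage_set0 setI0.
rewrite setTI; elim: n => [|n IH].
  by rewrite (_ : _ @^-1` _ = setT) //; apply/seteqP; split.
rewrite (_ : _ @^-1` _ = (f @^-1` cyl n s) `&`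
    (if s n then [set x | f x n] else ~` [set x | f x n])).
  apply: measurableI => //; case: (s n) => //; exact: measurableC.
apply/seteqP; split=> x /=.
  move=> xs; split; first by move=> i /ltnW; exact: xs.
  by have := xs n (ltnSn n); case: (s n) => /= ->.
move=> [xs xn] i; rewrite ltnS leq_eqVlt => /orP[/eqP->|/xs//].
by case: (s n) xn => /=; [|move/negP/negbTE].
Qed.

Definition raw_inf (s : nat -> bool) : Prop :=
  forall n b, exists2 i, (n <= i)%N & s i = b.

Definition of_raw (s : nat -> bool) : bseq :=
  if pselect (raw_inf s) is left h then BSeq h else point.

Lemma of_rawE s i : raw_inf s -> of_raw s i = s i.
Proof. by rewrite /of_raw; case: pselect. Qed.

Section MeasurableRaw.
Context d (T : measurableType d) (f : T -> nat -> bool).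
Hypothesis mf : forall i, measurable [set x | f x i].

Lemma measurable_raw_bit i b : measurable [set x | f x i = b].
Proof.
case: b; first exact: mf.
rewrite (_ : [set _ | _] = ~` [set x | f x i]); first exact/measurableC/mf.
by apply/seteqP; split=> x /=; case: (f x i).
Qed.

Lemma measurable_raw_inf : measurable [set x | raw_inf (f x)].
Proof.
rewrite (_ : [set _ | _] = \bigcap_n \bigcap_(b in [set: bool])
    \bigcup_(i in [set i | (n <= i)%N]) [set x | f x i = b]).
  apply: bigcapT_measurable => n; apply: fin_bigcap_measurable => [|b _].
    exact: finite_finset.
  by apply: bigcup_measurable => i _; exact: measurable_raw_bit.
apply/seteqP; split=> x /= xi n b.
  by move=> c _; have [i ni e] := xi n c; exists i.
by have [i ni e] := xi n I b I; exists i.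
Qed.

Lemma measurable_of_raw : measurable_fun setT (of_raw \o f).
Proof.
apply: measurable_fun_bseq => i.
rewrite (_ : [set _ | _] = ([set x | raw_inf (f x)] `&` [set x | f x i])
    `|` (~` [set x | raw_inf (f x)] `&` [set _ | (point : bseq) i])).
  apply: measurableU; apply: measurableI.
  - exact: measurable_raw_inf.
  - exact: mf.
  - by apply: measurableC; exact: measurable_raw_inf.
  - by case: ((point : bseq) i); [rewrite set_true|rewrite set_false].
apply/seteqP; split=> u /=; rewrite /of_raw; case: pselect => h /=;
  try by [left|right].
  by case=> -[].
by case=> -[].
Qed.

End MeasurableRaw.

Lemma cyls_setI : setI_closed cyls.
Proof.
have sub n m s t : (n <= m)%N -> cyls (cyl n s `&` cyl m t).
  move=> nm; have [ts|nts] := pselect (agree n t s).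
    right; exists m, t; apply/seteqP; split=> [u []//|u ut]; split=> // i ilt.
    by rewrite ut ?ts // (leq_trans ilt).
  left; apply/seteqP; split=> // u [us ut]; apply: nts => i ilt.
  by rewrite -us // ut // (leq_trans ilt).
move=> _ _ [->|[n [s ->]]] [->|[m [t ->]]]; try by left; rewrite ?(set0I, setI0).
by case/orP: (leq_total n m) => [|/sub h]; [exact: sub|rewrite setIC].
Qed.

Lemma bseq_measure_unique (m1 m2 : {measure set bseq -> \bar RR}) :
  (forall n s, m1 (cyl n s) = m2 (cyl n s)) -> (m1 setT < +oo)%E ->
  forall A, measurable A -> m1 A = m2 A.
Proof.
move=> m12 m1_fin A mA.
have cyl0 : cyl 0 point = setT by apply/seteqP; split.
apply: (measure_unique cyls (fun=> setT)) => //.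
- exact: cyls_setI.
- by move=> _; right; exists 0%N, point.
- by rewrite bigcup_const //; exists 0%N.
by move=> _ [->|[n [s ->]]]; rewrite ?measure0.
Qed.

Lemma flip_inf (s : bseq) (k n : nat) (b : bool) :
  exists2 i, (n <= i)%N & (s i (+) (i == k)) = b.
Proof.
apply: (@inf_tail s (fun i => s i (+) (i == k)) k.+1) => i ki.
by rewrite (gtn_eqF ki) addbF.
Qed.

Definition flip (s : bseq) k : bseq := BSeq (flip_inf s k).

Lemma cylS n s : cyl n s = cyl n.+1 s `|` cyl n.+1 (flip s n).
Proof.
apply/seteqP; split=> [t ts|t [] ts i ilt]; last 2 first.
- by apply: ts; exact: ltnW.
- by have := ts i (ltnW ilt); rewrite /= (ltn_eqF ilt) addbF.
have [e|ne] := eqVneq (t n) (s n); [left|right] => i;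
  rewrite ltnS leq_eqVlt => /orP[/eqP->|ilt] //=.
- exact: ts.
- by rewrite eqxx; case: (t n) ne; case: (s n).
by rewrite (ltn_eqF ilt) addbF; exact: ts.
Qed.

Lemma cylS_disj n s : cyl n.+1 s `&` cyl n.+1 (flip s n) = set0.
Proof.
apply/seteqP; split=> // t [/(_ n (ltnSn n)) + /(_ n (ltnSn n))] /= => ->.
by rewrite eqxx; case: (s n).
Qed.

Lemma measure_cylS (m : {measure set bseq -> \bar RR}) n s :
  m (cyl n s) = (m (cyl n.+1 s) + m (cyl n.+1 (flip s n)))%E.
Proof.
by rewrite cylS measureU ?cylS_disj //; exact: measurable_cyl.
Qed.

End Cylinders.

(** * Binary digits of real numbers *)

Section BinaryDigits.
Implicit Types u : RR.

Definition dtrunc (n : nat) u : nat := Num.truncn (2 ^+ n * u).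

Definition dbit u (n : nat) : bool := odd (dtrunc n.+1 u).

Lemma dtruncS u n : 0 <= u -> dtrunc n.+1 u = (2 * dtrunc n u + dbit u n)%N.
Proof.
move=> u0; have h k : 0 <= 2 ^+ k * u by rewrite mulr_ge0 ?exprn_ge0.
have /andP[lo hi] := truncn_itv (h n); have /andP[lo' hi'] := truncn_itv (h n.+1).
rewrite /dbit; rewrite -/(dtrunc n u) in lo hi; rewrite -/(dtrunc n.+1 u) in lo' hi'.
have e : 2 ^+ n.+1 * u = 2 * (2 ^+ n * u) by rewrite exprS mulrA.
have l1 : (2 * dtrunc n u < (dtrunc n.+1 u).+1)%N.
  by rewrite -(ltr_nat RR) natrM; apply: le_lt_trans hi'; rewrite e ler_pM2l.
have l2 : (dtrunc n.+1 u < 2 * (dtrunc n u).+1)%N.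
  by rewrite -(ltr_nat RR) natrM; apply: le_lt_trans lo' _; rewrite e ltr_pM2l.
have := odd_double_half (dtrunc n.+1 u); rewrite -mul2n; lia.
Qed.

Lemma dtrunc_itv u n : 0 <= u ->
  (dtrunc n u)%:R <= 2 ^+ n * u < (dtrunc n u).+1%:R.
Proof. by move=> u0; apply: truncn_itv; rewrite mulr_ge0 ?exprn_ge0. Qed.

(** Unlike in [bval], the first digit is the most significant: this is the integer part of [2^n * u]
    when [s] lists the digits of [u]. *)
Fixpoint mval (s : nat -> bool) (n : nat) : nat :=
  if n is m.+1 then (2 * mval s m + s m)%N else 0%N.

Lemma mval_lt s n : (mval s n < 2 ^ n)%N.
Proof. by elim: n => //= n IH; rewrite expnS; case: (s n); lia. Qed.

Lemma dtrunc_mval u n : 0 <= u < 1 -> dtrunc n u = mval (dbit u) n.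
Proof.
move=> /andP[u0 u1]; elim: n => [|n IH]; last by rewrite dtruncS // IH.
by apply: truncn_def; rewrite expr0 mul1r u0.
Qed.

Lemma mval_agree s t n : mval s n = mval t n <-> agree n s t.
Proof.
elim: n => [|n [IH1 IH2]]; first by split.
split=> /= [e i|st].
  have [eb en] : mval s n = mval t n /\ s n = t n.
    by move: e; case: (s n); case: (t n); lia.
  by rewrite ltnS leq_eqVlt => /orP[/eqP->//|]; exact: IH1.
by rewrite IH2 ?st // => i /ltnW; exact: st.
Qed.

Lemma pow2_bounded (x : RR) : (forall j, x * 2 ^+ j <= 1) -> x <= 0.
Proof.
move=> xj; rewrite leNgt; apply/negP => x0.
have := upper_nthrootP (leqnn (Num.bound x^-1)).
by rewrite ltNge -(ler_pM2l x0) mulfV ?gt_eqF // xj.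
Qed.

Definition dinf u : Prop := raw_inf (dbit u).

Lemma dtrunc_false u n j : 0 <= u -> (forall i, (n <= i)%N -> dbit u i = false) ->
  dtrunc (n + j) u = (2 ^ j * dtrunc n u)%N.
Proof.
move=> u0 uf; elim: j => [|j IH]; first by rewrite addn0 mul1n.
by rewrite addnS dtruncS // IH uf ?leq_addr // expnS; lia.
Qed.

Lemma dtrunc_true u n j : 0 <= u -> (forall i, (n <= i)%N -> dbit u i = true) ->
  (dtrunc (n + j) u).+1 = (2 ^ j * (dtrunc n u).+1)%N.
Proof.
move=> u0 uf; elim: j => [|j IH]; first by rewrite addn0 mul1n.
by rewrite addnS dtruncS // uf ?leq_addr // expnS; lia.
Qed.

Lemma not_dinf_dyadic u : 0 <= u -> ~ dinf u -> exists n k, u = k%:R / 2 ^+ n.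
Proof.
move=> u0 /existsNP[n /existsNP[b nb]]; exists n, (dtrunc n u).
have p0 k : 0 < 2 ^+ k :> RR by rewrite exprn_gt0.
have /andP[lo hi] := dtrunc_itv n u0.
have const i : (n <= i)%N -> dbit u i = ~~ b.
  move=> ni; have [e|] := eqVneq (dbit u i) b; first by case: nb; exists i.
  by case: (dbit u i); case: (b).
apply: (canRL (mulfK _)); first by rewrite gt_eqF.
rewrite mulrC; apply/eqP; rewrite eq_le lo andbT -subr_le0.
case: b {nb} const => const.
  apply: pow2_bounded => j; rewrite mulrBl.
  have /andP[_] := dtrunc_itv (n + j) u0.
  rewrite (dtrunc_false j u0 const) -[X in _ < X]natr1 natrM natrX exprD; lra.
(* Digits eventually [1] contradict the strict upper bound [hi] of the truncation. *)
suff : (dtrunc n u).+1%:R - 2 ^+ n * u <= 0 by lra.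
apply: pow2_bounded => j; rewrite mulrBl.
have /andP[+ _] := dtrunc_itv (n + j) u0.
have : (dtrunc (n + j) u)%:R + 1 = 2 ^+ j * (dtrunc n u).+1%:R :> RR.
  by rewrite natr1 (dtrunc_true j u0 const) natrM natrX.
rewrite exprD; lra.
Qed.

Definition dig u : bseq := of_raw (dbit u).

(** The value [0] is left out because all negative [u] truncate to it; an odd truncation is
    positive, so digits are still covered. *)
Lemma measurable_dtrunc n k :
  measurable [set u : measurableTypeR RR | dtrunc n u = k.+1].
Proof.
have p0 : 0 < 2 ^+ n :> RR by rewrite exprn_gt0.
rewrite (_ : [set _ | _] = `[(k.+1%:R / 2 ^+ n), (k.+2%:R / 2 ^+ n)[);
  first exact: measurable_itv.
apply/seteqP; split=> u /=; rewrite in_itv /= ler_pdivrMr // ltr_pdivlMr // mulrC.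
  move=> e; rewrite -e; apply: truncn_itv.
  have := truncn_gt0 (2 ^+ n * u); rewrite -/(dtrunc n u) e /= => /esym.
  by apply: le_trans.
exact: truncn_def.
Qed.

Lemma measurable_dbit n : measurable [set u : measurableTypeR RR | dbit u n].
Proof.
rewrite (_ : [set _ | _] = \bigcup_(k in [set k | odd k.+1])
    [set u : measurableTypeR RR | dtrunc n.+1 u = k.+1]).
  by apply: bigcup_measurable => k _; exact: measurable_dtrunc.
apply/seteqP; split=> [u|u [k /= ok e]]; last by rewrite /dbit /= e.
by rewrite /= /dbit; case E: (dtrunc n.+1 u) => [//|k] ok; exists k.
Qed.

Lemma measurable_dinf : measurable [set u : measurableTypeR RR | dinf u].
Proof. exact: measurable_raw_inf measurable_dbit. Qed.

Lemma measurable_dig : measurable_fun [set: measurableTypeR RR] dig.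
Proof. exact: measurable_of_raw measurable_dbit. Qed.

Definition unit_itv : set (measurableTypeR RR) := `[0, 1[.

Lemma measurable_unit_itv : measurable unit_itv.
Proof. exact: measurable_itv. Qed.

Definition coin : set bseq -> \bar RR :=
  pushforward (mrestr (@lebesgue_measure RR) measurable_unit_itv) dig.

Let measurable_preimage_dig (A : set bseq) : measurable A ->
  measurable (dig @^-1` A : set (measurableTypeR RR)).
Proof. by move=> mA; rewrite -[X in measurable X]setTI; exact: measurable_dig. Qed.

Let coin0 : coin set0 = 0%E.
Proof. by rewrite /coin /pushforward preimage_set0 measure0. Qed.
Let coin_ge0 A : (0 <= coin A)%E.
Proof. by rewrite /coin /pushforward measure_ge0. Qed.
Let coin_sigma_additive : semi_sigma_additive coin.
Proof.
move=> F mF tF mUF; rewrite /coin /pushforward preimage_bigcup.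
apply: measure_semi_sigma_additive => [n| |].
- exact: measurable_preimage_dig.
- apply/trivIsetP => /= i j _ _ ij; rewrite -preimage_setI.
  by move/trivIsetP : tF => /(_ _ _ _ _ ij) ->//; rewrite preimage_set0.
- by rewrite -preimage_bigcup; exact: measurable_preimage_dig.
Qed.

HB.instance Definition _ := isMeasure.Build _ _ _ coin
  coin0 coin_ge0 coin_sigma_additive.

Lemma coin_setT : coin setT = 1%:E.
Proof.
rewrite /coin /pushforward /mrestr preimage_setT setTI /unit_itv.
by rewrite lebesgue_measure_itv /= lte_fin ltr01 oppr0 adde0.
Qed.

HB.instance Definition _ := Measure_isProbability.Build _ _ _ coin coin_setT.

End BinaryDigits.

Section CoinMeasure.

Lemma measure_eq_off_null d (T : measurableType d) (R : realType)
    (m : {measure set T -> \bar R})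
    (A B N : set T) : measurable A -> measurable B -> measurable N -> m N = 0%E ->
  A `\` N = B `\` N -> m A = m B.
Proof.
move=> mA mB mN N0 AB.
have split_off C : measurable C -> m C = m (C `\` N).
  move=> mC; have e : m (C `&` N) = 0%E.
    by apply: (subset_measure0 _ mN _ N0) => //; exact: measurableI.
  by rewrite (measureDI m mC mN) [X in (_ + X)%E]e adde0.
by rewrite split_off // AB -split_off.
Qed.

Definition dyadic_null : set (measurableTypeR RR) :=
  unit_itv `&` ~` [set u | dinf u].

Lemma measurable_dyadic_null : measurable dyadic_null.
Proof.
apply: measurableI; first exact: measurable_unit_itv.
by apply: measurableC; exact: measurable_dinf.
Qed.

Lemma dyadic_null0 : @lebesgue_measure RR dyadic_null = 0%E.
Proof.
apply: countable_lebesgue_measure0.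
apply: (@sub_countable _ _ _ ((fun p : nat * nat => p.2%:R / 2 ^+ p.1) @` setT)).
  apply: subset_card_le => u [] /=; rewrite /unit_itv /= in_itv /= => /andP[u0 _].
  by move=> /(not_dinf_dyadic u0)[n [k ->]]; exists (n, k).
by apply: sub_countable (card_image_le _ _) _; exact: countableP.
Qed.

(** Off the countable set of dyadic numbers, the digits of [u] start as in [s] exactly when [u] lies
    in the dyadic interval [J] of length [2^-n]. *)
Lemma coin_cyl n (s : bseq) : coin (cyl n s) = ((2 ^+ n)^-1)%:E.
Proof.
have p0 : 0 < 2 ^+ n :> RR by rewrite exprn_gt0.
pose J : set (measurableTypeR RR) :=
  `[((mval s n)%:R / 2 ^+ n), ((mval s n).+1%:R / 2 ^+ n)[.
have -> : ((2 ^+ n)^-1)%:E = @lebesgue_measure RR J.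
  rewrite lebesgue_measure_itv /= lte_fin ltr_pM2r ?invr_gt0 // ltr_nat ltnSn.
  by rewrite -EFinB -mulrBl -natrB // subSnn mul1r.
have mJ : measurable J by exact: measurable_itv.
rewrite /coin /pushforward /mrestr.
apply: (measure_eq_off_null (N := dyadic_null)) => //.
- apply: measurableI; last exact: measurable_unit_itv.
  rewrite -[X in measurable X]setTI; apply: measurable_dig => //.
  exact: measurable_cyl.
- exact: measurable_dyadic_null.
- exact: dyadic_null0.
have unitP u : unit_itv u <-> 0 <= u < 1 by rewrite /unit_itv /= in_itv.
have JP u : J u <-> (mval s n)%:R <= 2 ^+ n * u < (mval s n).+1%:R.
  by rewrite /J /= in_itv /= ler_pdivrMr // ltr_pdivlMr // (mulrC u).
have J_unit u : J u -> unit_itv u.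
  move=> /JP/andP[lo hi]; apply/unitP; apply/andP; split.
    by rewrite -(pmulr_rge0 _ p0); apply: le_trans lo.
  rewrite -(ltr_pM2l p0) mulr1; apply: lt_le_trans hi _.
  by rewrite -natrX ler_nat mval_lt.
have main u : unit_itv u -> dinf u -> cyl n s (dig u) <-> J u.
  move=> /unitP u01 du; have /andP[u0 _] := u01.
  have -> : J u <-> dtrunc n u = mval s n.
    rewrite JP; split; first exact: truncn_def.
    by move=> <-; exact: dtrunc_itv.
  rewrite dtrunc_mval // mval_agree; split=> h i ilt.
    by rewrite -h // /dig of_rawE.
  by rewrite /dig of_rawE // h.
apply/seteqP; split=> u [].
  move=> [us u1] nu; split=> //.
  by apply/main => //; apply: contrapT => du; apply: nu.
move=> Ju nu; split=> //; split; last exact: J_unit.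
by apply/main => //; [exact: J_unit|apply: contrapT => du; apply: nu; split=> //;
  exact: J_unit].
Qed.

(* A bijection that preserves agreement up to every large level permutes the
   cylinders of each such level. *)
Lemma coin_preserving (psi : bseq -> bseq) (M : nat) :
  measurable_fun setT psi -> (forall t, exists s, psi s = t) ->
  (forall n (s t : bseq), (M <= n)%N -> agree n s t <-> agree n (psi s) (psi t)) ->
  forall A, measurable A -> coin (psi @^-1` A) = coin A.
Proof.
move=> mpsi psi_surj psi_agree A mA.
pose m1 : {measure set bseq -> \bar RR} :=
  measure_function_pushforward__canonical__measure_function_Measure coin mpsi.
suff h n s : m1 (cyl n s) = coin (cyl n s).
  by apply: (bseq_measure_unique h) => //;
    rewrite /= /pushforward preimage_setT coin_setT ltry.
(* Induction on the distance to level [M]: below it a cylinder is split in two, from it on [psi]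
   permutes cylinders. *)
have [d Mnd] : exists d, (M <= n + d)%N by exists M; exact: leq_addl.
elim: d n s Mnd => [|d IH] n s; last first.
  by rewrite addnS -addSn => Mnd; rewrite measure_cylS [RHS]measure_cylS !IH.
rewrite addn0 => Mn; have [t ts] := psi_surj s.
have e : psi @^-1` cyl n s = cyl n t.
  apply/seteqP; split=> u us.
    by apply: (proj2 (psi_agree n u t Mn)); rewrite ts.
  by have := proj1 (psi_agree n u t Mn) us; rewrite ts.
by rewrite -[LHS]/(coin (psi @^-1` cyl n s)) e !coin_cyl.
Qed.

End CoinMeasure.

(** * Standard Borel spaces *)

Section StandardBorel.

Lemma mval_grow (s : nat -> bool) n j :
  (2 ^ j * mval s n <= mval s (n + j) < 2 ^ j * (mval s n).+1)%N.
Proof.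
elim: j => [|j IH]; first by rewrite addn0 !mul1n leqnn ltnSn.
by rewrite addnS /= expnS; case: (s _); lia.
Qed.

Definition dsum (s : nat -> bool) (n : nat) : RR := (mval s n)%:R / 2 ^+ n.

(** A digit [0] at some [i >= n] keeps the sums away from the right end of the interval. The strict
    gap survives the supremum, so truncating [undig s] returns the digits of [s]. *)
Lemma dsum_lt (s : bseq) n :
  exists2 c, (forall m, dsum s m <= c) & c < (mval s n).+1%:R / 2 ^+ n.
Proof.
have p0 k : 0 < 2 ^+ k :> RR by rewrite exprn_gt0.
have [i ni si] := bs_inf s n false.
exists ((mval s i.+1).+1%:R / 2 ^+ i.+1) => [m|].
  rewrite /dsum ler_pdivrMr // mulrAC ler_pdivlMr //.
  rewrite -!natrX -!natrM ler_nat.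
  case/orP: (leq_total m i.+1) => /subnK <-; rewrite addnC.
    have := mval_grow s m (i.+1 - m); rewrite expnD.
    by have := expn_gt0 2 m; nia.
  have := mval_grow s i.+1 (m - i.+1); rewrite expnD.
  by have := expn_gt0 2 i.+1; nia.
rewrite ltr_pdivrMr // mulrAC ltr_pdivlMr //.
rewrite -!natrX -!natrM ltr_nat /= si addn0 expnS.
have := mval_grow s n (i - n); rewrite subnKC // => /andP[_ h].
have -> : (2 ^ i = 2 ^ (i - n) * 2 ^ n)%N by rewrite -expnD subnK.
have := expn_gt0 2 n; have := expn_gt0 2 (i - n).
move: (mval s i) (mval s n) (2 ^ (i - n))%N (2 ^ n)%N h => a b c d h /= c0 d0.
have h1 : (a.+1 <= c * b.+1)%N by [].
have h2 : (a.+1 * d <= c * b.+1 * d)%N by rewrite leq_mul2r h1 orbT.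
nia.
Qed.

Definition undig (s : bseq) : RR := sup (range (dsum s)).

Lemma dsum_has_ub (s : bseq) : has_ubound (range (dsum s)).
Proof. by have [c cP _] := dsum_lt s 0; exists c => _ [m _ <-]. Qed.

Lemma dsum_range0 (s : bseq) : range (dsum s) !=set0.
Proof. by exists (dsum s 0), 0%N. Qed.

Lemma dsum_le_undig (s : bseq) n : dsum s n <= undig s.
Proof. by apply: ub_le_sup; [exact: dsum_has_ub|exists n]. Qed.

Lemma dtrunc_undig (s : bseq) n : dtrunc n (undig s) = mval s n.
Proof.
have p0 : 0 < 2 ^+ n :> RR by rewrite exprn_gt0.
apply: truncn_def; rewrite mulrC -ler_pdivrMr // dsum_le_undig /=.
rewrite -ltr_pdivlMr //; have [c cP] := dsum_lt s n; apply: le_lt_trans.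
by apply: ge_sup; [exact: dsum_range0|move=> _ [m _ <-]].
Qed.

Lemma undigK : cancel undig dig.
Proof.
move=> s; have u0 : 0 <= undig s.
  by apply: le_trans (dsum_le_undig s 0); rewrite /dsum mul0r.
have dE i : dbit (undig s) i = s i.
  have := dtruncS i u0; rewrite !dtrunc_undig /=.
  by case: (s i); case: (dbit _ i); lia.
apply: bseq_ext => i; rewrite /dig of_rawE ?dE // => n b.
by have [j nj <-] := bs_inf s n b; exists j.
Qed.

Lemma measurable_undig : measurable_fun setT (undig : bseq -> measurableTypeR RR).
Proof.
apply: (measurability _ (measurable_realfun.RGenOInfty.measurableE RR)).
move=> _ [_ [c ->] <-].
rewrite setTI (_ : _ @^-1` _ = \bigcup_n [set s : bseq | c < dsum s n]).
  apply: bigcupT_measurable => n; apply: (@measurable_level n) => s t st /=.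
  by rewrite /dsum (_ : mval s n = mval t n) //; apply/mval_agree.
apply/seteqP; split=> s /=; rewrite in_itv /= andbT.
  by move=> /(sup_gt (dsum_range0 s))[_ [n _ <-] cn]; exists n.
by move=> [n _ /= cn]; apply: lt_le_trans cn (dsum_le_undig s n).
Qed.

(** The retraction makes the image of [e] the measurable set where [e (r u) = u], and images of
    measurable sets become preimages under [r]; the Lusin-Souslin theorem is thereby avoided. *)
Definition borel_retract d (X : measurableType d) : Prop :=
  exists (e : X -> bseq) (r : bseq -> X),
    [/\ measurable_fun setT e, measurable_fun setT r & cancel e r].

Section BorelRetract.
Context d (X : measurableType d).
Hypothesis X_retract : borel_retract X.

Lemma borel_retract_real : exists (e : X -> measurableTypeR RR)
    (r : measurableTypeR RR -> X),
  [/\ measurable_fun setT e, measurable_fun setT r & cancel e r].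
Proof.
have [e [r [me mr er]]] := X_retract; exists (undig \o e), (r \o dig); split.
- exact: measurableT_comp measurable_undig me.
- exact: measurableT_comp mr measurable_dig.
by move=> x; rewrite /= undigK er.
Qed.

Lemma borel_retract_standard : standard_borel X.
Proof.
have [e [r [me mr er]]] := borel_retract_real.
have mrange : measurable (range e).
  have -> : range e = [set u | e (r u) == u].
    apply/seteqP; split=> [_ [x _ <-]|u /= /eqP eu]; first by rewrite /= er.
    by exists (r u).
  rewrite -[X in measurable X]setTI.
  have me' : measurable_fun setT (e \o r) by exact: measurableT_comp.
  exact: (measurable_fun_eqr me' (@measurable_id _ _ setT) measurableT
    (Y := [set true])).
exists e, (range e); split=> //; split; first exact: can_inj er.
do 2!split=> //; move=> A mA.
have -> : e @` A = range e `&` r @^-1` A.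
  apply/seteqP; split=> [_ [x Ax <-]|_ [[x _ <-]]] /=.
    by split; [exists x|rewrite er].
  by rewrite er => Ax; exists x.
apply: measurableI => //; rewrite -[X in measurable X]setTI; exact: mr.
Qed.

Lemma measurable_eq_fun d' (Y : measurableType d') (f g : Y -> X) :
  measurable_fun setT f -> measurable_fun setT g ->
  measurable [set y | f y = g y].
Proof.
move=> mf mg; have [e [r [me mr er]]] := borel_retract_real.
have -> : [set y | f y = g y] = [set y | e (f y) == e (g y)].
  by apply/seteqP; split=> y /=; [move=> ->|move/eqP/(can_inj er)].
rewrite -[X in measurable X]setTI.
have mef : measurable_fun setT (e \o f) by exact: measurableT_comp.
have meg : measurable_fun setT (e \o g) by exact: measurableT_comp.
exact: (measurable_fun_eqr mef meg measurableT (Y := [set true])).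
Qed.

End BorelRetract.

Definition interleave (p : bseq * bseq) (i : nat) : bool :=
  if odd i then p.2 i./2 else p.1 i./2.

Lemma interleave_inf p : raw_inf (interleave p).
Proof.
move=> n b; have [j nj e] := bs_inf p.1 n b; exists j.*2; first by lia.
by rewrite /interleave odd_double doubleK.
Qed.

Lemma borel_retract_pair : borel_retract (bseq * bseq)%type.
Proof.
exists (of_raw \o interleave),
  (fun s : bseq => (of_raw (fun i => s i.*2), of_raw (fun i => s i.*2.+1))); split.
- apply: measurable_of_raw => i; rewrite /interleave; case: (odd i).
    rewrite -[X in measurable X]setTI.
    apply: (measurable_snd measurableT [set s : bseq | s i./2 = true]).
    exact: measurable_bit.
  rewrite -[X in measurable X]setTI.
  apply: (measurable_fst measurableT [set s : bseq | s i./2 = true]).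
  exact: measurable_bit.
- by apply: measurable_fun_pair; apply: measurable_of_raw => i; exact: measurable_bit.
move=> [s t]; congr pair; apply: bseq_ext => i.
  have e j : of_raw (interleave (s, t)) j.*2 = s j.
    by rewrite of_rawE ?/interleave ?odd_double ?doubleK //; exact: interleave_inf.
  by rewrite of_rawE ?e // => n b; have [j nj <-] := bs_inf s n b; exists j;
    rewrite ?e.
have e j : of_raw (interleave (s, t)) j.*2.+1 = t j.
  rewrite of_rawE; last exact: interleave_inf.
  by rewrite /interleave /= odd_double /= uphalf_double.
by rewrite of_rawE ?e // => n b; have [j nj <-] := bs_inf t n b; exists j; rewrite ?e.
Qed.

End StandardBorel.

(** * Orbit equivalence *)

Section SkewProduct.
Local Open Scope ereal_scope.
Context d1 d2 (X : measurableType d1) (Y : measurableType d2) (R : realType).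
Variable m1 : {measure set X -> \bar R}.
Variable m2 : {sigma_finite_measure set Y -> \bar R}.

(** By Fubini: the section at [x] of the preimage is the [psi x]-preimage of the section of [A] at
    [tau x]. *)
Lemma skew_product_preserving (tau : X -> X) (psi : X -> Y -> Y) :
  measurable_fun setT tau ->
  (forall A, measurable A -> m1 (tau @^-1` A) = m1 A) ->
  (forall x A, measurable A -> m2 (psi x @^-1` A) = m2 A) ->
  forall A, measurable A ->
  (m1 \x m2) ((fun p => (tau p.1, psi p.1 p.2)) @^-1` A) = (m1 \x m2) A.
Proof.
move=> mtau tau_m psi_m A mA; rewrite /product_measure1.
transitivity (\int[m1]_x ((m2 \o xsection A) \o tau) x).
  apply: eq_integral => x _ /=; rewrite -(psi_m x (xsection A (tau x)));
    last exact: measurable_xsection.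
  congr (m2 _); apply/seteqP; split=> y; rewrite /preimage /xsection /= !in_setE.
rewrite -[in LHS](preimage_setT tau) -(ge0_integral_pushforward mtau) //; last first.
  exact: measurable_fun_xsection.
by apply: eq_measure_integral => B mB _; exact: tau_m.
Qed.

End SkewProduct.

Section ActionsPreserveMeasure.

Lemma measurable_odo k : measurable_fun setT (odo k).
Proof.
apply: measurable_fun_bseq => i; apply: (@measurable_level i.+1) => s t st.
rewrite -[X in X -> _]/(is_true (odo k s i)) -[X in _ -> X]/(is_true (odo k t i)).
by rewrite (proj1 (odo_agree k s t i.+1) st i).
Qed.

Lemma coin_odo k A : measurable A -> coin (odo k @^-1` A) = coin A.
Proof.
apply: (@coin_preserving _ 0%N); first exact: measurable_odo.
  by move=> t; exists (odo (- k) t); rewrite odoD subrr odo0.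
by move=> n s t _; exact: odo_agree.
Qed.

Lemma measurable_lamp_fib p z : measurable_fun setT (lamp_fib p z).
Proof.
case: p => f k; apply: measurable_fun_bseq => i.
set j := lam z (kap (odo k z) i + k); set b := kap (odo k z) i \in f.
rewrite (_ : [set _ | _] = [set y : bseq | y j = ~~ b]); first exact: measurable_bit.
apply/funext => y; apply/propext.
rewrite -[X in X <-> _]/(is_true (lamp_fib (f, k) z y i)) lamp_fibE -/j -/b /=.
by case: (y j); case: b.
Qed.

Lemma lamp_fib_surj p z t : exists y, lamp_fib p z y = t.
Proof.
pose x := lamp_act (ginv p) (odo p.2 z, t).
have e : lamp_act p x = (odo p.2 z, t).
  by rewrite /x -lamp_actM monoid.mulgV lamp_act1.
have xz : x.1 = z by rewrite /x /lamp_act /= odoD addNr odo0.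
by exists x.2; move: e; rewrite /lamp_act xz => -[].
Qed.

(** The relabelling [sigma] is a bijection fixing every label from [M] on, so it permutes the labels
    below any [n >= M]. *)
Lemma lamp_fib_agree p z : exists M, forall n (y y' : bseq), (M <= n)%N ->
  agree n y y' <-> agree n (lamp_fib p z y) (lamp_fib p z y').
Proof.
case: p => f k; have [M MP] := lamp_fib_tail (f, k) z; rewrite /= in MP.
pose sigma l := lam z (kap (odo k z) l + k).
pose sigma' j := lam (odo k z) (kap z j - k).
have sK : cancel sigma sigma' by move=> l; rewrite /sigma /sigma' kapK addrK lamK.
have s'K : cancel sigma' sigma by move=> l; rewrite /sigma /sigma' kapK subrK lamK.
have sM l : (M <= l)%N -> sigma l = l by move=> /MP[].
exists M => n y y' Mn; split=> yy' l ln.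
  rewrite !lamp_fibE yy' // -/(sigma l) ltnNge; apply/negP => nl.
  have e := sM _ (leq_trans Mn nl); have e' := can_inj sK e.
  by rewrite e' leqNgt ln in nl.
have s'n : (sigma' l < n)%N.
  rewrite ltnNge; apply/negP => nl.
  have e := sM _ (leq_trans Mn nl); rewrite s'K in e.
  by rewrite -e leqNgt ln in nl.
have := yy' _ s'n; rewrite !lamp_fibE -/(sigma (sigma' l)) s'K.
by case: (y l); case: (y' l); case: (_ \in _).
Qed.

Lemma coin_lamp_fib p z A : measurable A -> coin (lamp_fib p z @^-1` A) = coin A.
Proof.
have [M MP] := lamp_fib_agree p z; apply: (coin_preserving _ _ MP).
  exact: measurable_lamp_fib.
exact: lamp_fib_surj.
Qed.

Lemma measurable_lamp_act p : measurable_fun setT (lamp_act p).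
Proof.
apply: measurable_fun_pair.
  exact: measurableT_comp (measurable_odo _) measurable_fst.
case: p => f k; apply: measurable_fun_bseq => i.
(* The digit read depends on [z], so the set is cut by the old label [j] and the digit [b]; each
   condition on [z] involves finitely many digits. *)
pose Z j b := [set z : bseq | kap z j = kap (odo k z) i + k /\
                              (kap (odo k z) i \in f) = ~~ b].
rewrite (_ : [set _ | _] = \bigcup_j \bigcup_(b in [set: bool])
    (Z j b `*` [set y : bseq | y j = b])).
  apply: bigcupT_measurable => j; apply: fin_bigcup_measurable => [|b _].
    exact: finite_finset.
  apply: measurableX; last exact: measurable_bit.
  apply: (@measurable_level (maxn i j).+1) => s t st [] e1 e2.
  have ej : kap t j = kap s j.
    by apply: kap_agree => l lj; rewrite st // ltnS leq_max lj orbT.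
  have ei : kap (odo k t) i = kap (odo k s) i.
    apply: kap_agree => l li.
    rewrite (proj1 (odo_agree k s t (maxn i j).+1) st) //.
    by rewrite ltnS leq_max li.
  by rewrite /Z /= ej ei.
apply/seteqP; split=> -[z y].
  rewrite -[X in X -> _]/(is_true (lamp_fib (f, k) z y i)) lamp_fibE.
  move=> h; exists (lam z (kap (odo k z) i + k)) => //.
  exists (y (lam z (kap (odo k z) i + k))) => //; split=> //.
  by split; [rewrite kapK|move: h; case: (y _); case: (_ \in _)].
move=> [j _ [b _ [[/= e1 e2] /= e3]]].
change (is_true (lamp_fib (f, k) z y i)).
by rewrite lamp_fibE -e1 lamK e2 e3; case: (b).
Qed.

Lemma measurable_zz_act q : measurable_fun setT (zz_act q).
Proof.
by apply: measurable_fun_pair; apply: measurableT_comp (measurable_odo _) _.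
Qed.

Definition coin2 : probability (bseq * bseq)%type RR := (coin \x coin)%E.

Lemma coin2_lamp_act p A : measurable A -> coin2 (lamp_act p @^-1` A) = coin2 A.
Proof.
apply: (skew_product_preserving (measurable_odo p.2)) => [B|z B].
  exact: coin_odo.
exact: coin_lamp_fib.
Qed.

Lemma coin2_zz_act q A : measurable A -> coin2 (zz_act q @^-1` A) = coin2 A.
Proof.
apply: (skew_product_preserving (psi := fun _ => odo q.2) (measurable_odo q.1))
  => [B|z B].
  exact: coin_odo.
exact: coin_odo.
Qed.

Lemma lamp_mp_action : mp_action coin2 lamp_act.
Proof.
split; first exact: lamp_act1.
split; first exact: lamp_actM.
split; first exact: measurable_lamp_act.
exact: coin2_lamp_act.
Qed.

Lemma zz_mp_action : mp_action coin2 zz_act.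
Proof.
split; first exact: zz_act1.
split; first exact: zz_actM.
split; first exact: measurable_zz_act.
exact: coin2_zz_act.
Qed.

Lemma zz_lamp_orbit x : Defs.orbit zz_act x = Defs.orbit lamp_act x.
Proof.
apply/seteqP; split=> [_ [q _ <-]|_ [p _ <-]].
  by have [p e] := zz_act_lamp q x; exists p.
by have [q e] := lamp_act_zz p x; exists q.
Qed.

Lemma zz_lamp_orbit_equivalent : orbit_equivalent coin2 zz_act coin2 lamp_act.
Proof.
exists setT, setT, id; do 2!split=> //.
rewrite setCT measure0; do 2!split=> //; split.
  by split=> // x _; exists x.
split; first exact: measurable_id.
split=> [A mA _|x _]; first by rewrite image_id.
by rewrite !setIT image_id zz_lamp_orbit.
Qed.

End ActionsPreserveMeasure.

(** * Measure equivalence *)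

Section Coupling.

HB.instance Definition _ := Countable.on zz.
HB.instance Definition _ := isPointed.Build zz (0, 0).
HB.instance Definition _ := @isMeasurable.Build default_measure_display zz
  discrete_measurable discrete_measurable0
  discrete_measurableC discrete_measurableU.

Definition zz_counting : set zz -> \bar RR := counting.

HB.instance Definition _ := Measure.on zz_counting.

Lemma sigma_finite_zz_counting : sigma_finite [set: zz] zz_counting.
Proof.
exists (fun n => [set p : zz | (choice.pickle p <= n)%N]).
  by apply/seteqP; split=> // p _; exists (choice.pickle p) => /=.
move=> n; split=> //; rewrite /zz_counting /counting asboolT ?ltry //.
apply: sub_finite_set (finite_preimage (f := @choice.pickle zz) _ (finite_II n.+1)).
  by move=> p /=; rewrite ltnS.
by move=> p q _ _; apply: (pcan_inj (@choice.pickleK zz)).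
Qed.

HB.instance Definition _ :=
  Measure_isSigmaFinite.Build _ _ _ zz_counting sigma_finite_zz_counting.

Lemma zz_counting_bij (f g : zz -> zz) A : cancel f g -> cancel g f ->
  zz_counting (f @^-1` A) = zz_counting A.
Proof.
move=> fK gK.
have e : f @^-1` A = g @` A.
  apply/seteqP; split=> [p Afp|_ [p Ap <-]]; first by exists (f p).
  by rewrite /preimage /= gK.
have gI : injective g := can_inj gK.
have [finA|infA] := pselect (finite_set A).
  have finfA : finite_set (g @` A) by exact: finite_image.
  rewrite e /zz_counting /counting !asboolT //; congr (_%:R%:E).
  by rewrite fset_set_image // card_imfset.
rewrite /zz_counting /counting !asboolF // => fin; apply: infA.
apply: sub_finite_set (finite_image f fin) => p Ap.
by exists (g p); rewrite ?gK // /preimage /= gK.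
Qed.

Lemma measurable_by_zz d (T : measurableType d) (c : T -> zz) (A : set T) :
  (forall q, measurable (A `&` [set x | c x = q])) -> measurable A.
Proof.
move=> mA.
have -> : A = \bigcup_n (A `&` [set x | choice.pickle (c x) = n]).
  by apply/seteqP; split=> [x Ax|x [n _ []]] //; exists (choice.pickle (c x)).
apply: bigcupT_measurable => n.
have [[q qn]|no] := pselect (exists q : zz, choice.pickle q = n); last first.
  rewrite (_ : _ `&` _ = set0) //.
  by apply/seteqP; split=> // x [_ /= cn]; apply: no; exists (c x).
rewrite (_ : [set _ | _] = [set x | c x = q]) //.
apply/seteqP; split=> x /=; last by move=> ->.
by rewrite -qn => /(pcan_inj (@choice.pickleK zz)).
Qed.

Lemma measurable_fun_zz d (T : measurableType d) (f : T -> zz) :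
  (forall q, measurable [set x | f x = q]) -> measurable_fun setT f.
Proof.
move=> mf _ B _; rewrite setTI; apply: (measurable_by_zz (c := f)) => q.
have [Bq|nBq] := pselect (B q).
  rewrite (_ : _ `&` _ = [set x | f x = q]) //.
  by apply/seteqP; split=> [x []//|x /= fx]; split=> //; rewrite /preimage /= fx.
rewrite (_ : _ `&` _ = set0) //.
by apply/seteqP; split=> // x [+ /= fx]; rewrite /preimage /= fx.
Qed.

Definition first_false (s : bseq) : nat :=
  ex_minn (let: ex_intro2 i _ si := bs_inf s 0 false in
           ex_intro (fun i => ~~ s i) i (negbT si)).

Lemma first_falseP (s : bseq) v :
  first_false s = v <-> (forall i, (i < v)%N -> s i = true) /\ s v = false.
Proof.
rewrite /first_false; case: ex_minnP => n /negbTE sn nmin; split.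
  move=> <-; split=> // i ilt; apply: contraTT ilt => /nmin.
  by rewrite -leqNgt.
move=> [lt_v sv]; apply/eqP; rewrite eqn_leq nmin ?sv // leqNgt.
by apply/negP => /lt_v; rewrite sn.
Qed.

(** Unary code of [k], closed by a zero and followed by [s]: it absorbs a countable factor into a
    binary sequence. *)
Definition prefix_code (s : bseq) (k i : nat) : bool :=
  if (i < k)%N then true else if i == k then false else s (i - k.+1)%N.

Lemma prefix_codeD s k i : prefix_code s k (i + k.+1) = s i.
Proof. by rewrite /prefix_code; case: ltnP; [lia|]; case: eqP; [lia|];
  rewrite addnK. Qed.

Lemma prefix_code_inf s k : raw_inf (prefix_code s k).
Proof.
move=> n b; have [i ni si] := bs_inf s n b; exists (i + k.+1)%N; first by lia.
by rewrite prefix_codeD.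
Qed.

Lemma first_false_prefix (s : bseq) k : first_false (of_raw (prefix_code s k)) = k.
Proof.
apply/first_falseP; split=> [i ik|]; rewrite of_rawE; try exact: prefix_code_inf.
  by rewrite /prefix_code ik.
by rewrite /prefix_code ltnn eqxx.
Qed.

Lemma measurable_first_false v : measurable [set s : bseq | first_false s = v].
Proof.
apply: (@measurable_level v.+1) => s t st /= /first_falseP[sv1 sv2].
apply/first_falseP; split=> [i iv|]; first by rewrite -st ?sv1 // ltnW.
by rewrite -st.
Qed.

Definition nat_zz (n : nat) : zz := odflt (0, 0) (@choice.unpickle zz n).

Lemma borel_retract_zz d (X : measurableType d) :
  borel_retract X -> borel_retract (X * zz)%type.
Proof.
move=> [e [r [me mr er]]].
pose code (w : X * zz) i := prefix_code (e w.1) (choice.pickle w.2) i.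
pose tail (s : bseq) i := s (i + (first_false s).+1)%N.
pose lab (s : bseq) := nat_zz (first_false s).
exists (of_raw \o code), (fun s => (r (of_raw (tail s)), lab s)); split.
- apply: measurable_of_raw => i; apply: (measurable_by_zz (c := snd)) => q.
  rewrite (_ : _ `&` _ = [set x | prefix_code (e x) (choice.pickle q) i] `*` [set q]).
    apply: measurableX => //; rewrite /prefix_code.
    case: ltnP => _; first by rewrite set_true.
    case: eqP => _; first by rewrite set_false.
    rewrite -[X in measurable X]setTI.
    exact: (me measurableT
      [set s : bseq | s (i - (choice.pickle q).+1)%N = true] (measurable_bit _ _)).
  by apply/seteqP; split=> -[x p] [] /=; rewrite /code /= => + e1; rewrite e1.
- apply: measurable_fun_pair.
    apply: measurableT_comp => //; apply: measurable_of_raw => i.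
    rewrite (_ : [set _ | _] = \bigcup_v ([set s : bseq | first_false s = v] `&`
      [set s : bseq | s (i + v.+1)%N = true])).
      apply: bigcupT_measurable => v; apply: measurableI.
        exact: measurable_first_false.
      exact: measurable_bit.
    apply/seteqP; split=> [s si|s [v _ [/= <-]]] //; by exists (first_false s).
  apply: measurable_fun_zz => q.
  rewrite (_ : [set _ | _] = \bigcup_v ([set s : bseq | first_false s = v] `&`
      [set _ | nat_zz v = q])).
    apply: bigcupT_measurable => v; apply: measurableI.
      exact: measurable_first_false.
    by have [h|h] := pselect (nat_zz v = q);
      [rewrite (_ : mkset _ = setT)|rewrite (_ : mkset _ = set0)] => //;
        apply/seteqP; split.
  by apply/seteqP; split=> [s si|s [v _ [/= <-]]] //; exists (first_false s).
move=> [x q]; rewrite /= /lab /nat_zz first_false_prefix choice.pickleK /=;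
  congr pair.
rewrite -[RHS]er; congr r; apply: bseq_ext => i.
have tE j : tail (of_raw (code (x, q))) j = e x j.
  rewrite -[code (x, q)]/(prefix_code (e x) (choice.pickle q)) /tail
    first_false_prefix.
  by rewrite (of_rawE _ (@prefix_code_inf _ _)) prefix_codeD.
rewrite of_rawE ?tE // => n b; have [j nj <-] := bs_inf (e x) n b.
by exists j => //; rewrite tE.
Qed.

(** The Zimmer cocycle of the orbit equivalence; freeness of [zz_act] makes it unique. *)
Definition coc (h : lamp) (x : bseq * bseq) : zz := projT1 (cid (lamp_act_zz h x)).

Lemma cocP h x : zz_act (coc h x) x = lamp_act h x.
Proof. by rewrite /coc; case: cid. Qed.

Lemma free_action_inj (G : groupType) (X : Type) (a : G -> X -> X) x g h :
  (forall x, a gone x = x) -> (forall g h x, a (gmul g h) x = a g (a h x)) ->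
  free_action a -> a g x = a h x -> g = h.
Proof.
move=> a1 aM afree e; apply: (monoid.mulgI (ginv h)); rewrite monoid.mulVg.
by apply: (afree _ x); rewrite aM e -aM monoid.mulVg a1.
Qed.

Lemma coc_uniq h x q : zz_act q x = lamp_act h x -> coc h x = q.
Proof.
rewrite -cocP => e; apply/esym.
exact: (free_action_inj zz_act1 zz_actM zz_act_free e).
Qed.

Lemma coc1 x : coc gone x = gone.
Proof. by apply: coc_uniq; rewrite zz_act1 lamp_act1. Qed.

Lemma cocM g h x : coc (gmul g h) x = gmul (coc g (lamp_act h x)) (coc h x).
Proof. by apply: coc_uniq; rewrite zz_actM !cocP lamp_actM. Qed.

Lemma measurable_coc h q : measurable [set x | coc h x = q].
Proof.
rewrite (_ : [set _ | _] = [set x | zz_act q x = lamp_act h x]).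
  apply: (measurable_eq_fun borel_retract_pair); first exact: measurable_zz_act.
  exact: measurable_lamp_act.
by apply/seteqP; split=> x /=; [move=> <-; exact: cocP|exact: coc_uniq].
Qed.

Definition coupling := (bseq * bseq * zz)%type.

(* [(x, g)] stands for the pair [(x, g x)] of the orbit relation; the two
   groups act on the two coordinates of the pair. *)
Definition coupling_zz (k : zz) (w : coupling) : coupling := (w.1, gmul k w.2).
(** The factor [(coc h x)^-1] keeps the second point fixed: applied to [h x], it gives back [x]. *)
Definition coupling_lamp (h : lamp) (w : coupling) : coupling :=
  (lamp_act h w.1, gmul w.2 (ginv (coc h w.1))).

Definition coupling_measure : {measure set coupling -> \bar RR} :=
  (coin2 \x zz_counting)%E.

Lemma coupling_slab (A : set zz) :
  coupling_measure ([set: bseq * bseq] `*` A) = zz_counting A.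
Proof.
by rewrite [LHS]product_measure1E // [X in (X * _)%E]probability_setT mul1e.
Qed.

Lemma sigma_finite_coupling : sigma_finite setT coupling_measure.
Proof.
have [F FT Ffin] := sigma_finite_zz_counting.
exists (fun n => [set: bseq * bseq] `*` F n).
  apply/seteqP; split=> // -[x g] _.
  have : [set: zz] g by [].
  by rewrite FT => -[n _ Fn]; exists n.
move=> n; have [mF F_lt] := Ffin n; split; first exact: measurableX.
by rewrite coupling_slab.
Qed.

Lemma measurable_coupling_zz k : measurable_fun setT (coupling_zz k).
Proof.
apply: measurable_fun_pair; first exact: measurable_fst.
exact: (measurableT_comp (f := fun g => gmul k g) _ measurable_snd).
Qed.

Lemma measurable_coupling_lamp h : measurable_fun setT (coupling_lamp h).
Proof.
apply: measurable_fun_pair.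
  exact: measurableT_comp (measurable_lamp_act h) measurable_fst.
apply: measurable_fun_zz => v; apply: (measurable_by_zz (c :=
  fun w => coc h w.1)) => q.
rewrite (_ : _ `&` _ = [set x | coc h x = q] `*` [set gmul v q]).
  by apply: measurableX => //; exact: measurable_coc.
apply/seteqP; split=> -[x g] [] /=.
  by move=> <- <-; rewrite monoid.mulgVK.
by move=> -> ->; rewrite monoid.mulgK.
Qed.

Lemma coupling_zz_mp : mp_action coupling_measure coupling_zz.
Proof.
split; first by move=> [x g]; rewrite /coupling_zz /= monoid.mul1g.
split; first by move=> g h [x k]; rewrite /coupling_zz /= monoid.mulgA.
split; first exact: measurable_coupling_zz.
move=> k A mA; apply: (skew_product_preserving (tau := id) (psi :=
  fun _ g => gmul k g)) => //.
move=> x B _; apply: (zz_counting_bij (g := fun g => gmul (ginv k) g)) => g.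
  by rewrite monoid.mulKg.
by rewrite monoid.mulVKg.
Qed.

Lemma coupling_lamp_mp : mp_action coupling_measure coupling_lamp.
Proof.
split.
  by move=> [x g]; rewrite /coupling_lamp /= lamp_act1 coc1 monoid.invg1 monoid.mulg1.
split.
  move=> g h [x k]; rewrite /coupling_lamp /= lamp_actM cocM monoid.invgM.
  by rewrite monoid.mulgA.
split; first exact: measurable_coupling_lamp.
move=> h A mA; have bij x B : zz_counting ((fun g => gmul g (ginv (coc h x))) @^-1` B)
    = zz_counting B.
  apply: (zz_counting_bij (g := fun g => gmul g (coc h x))) => g.
    by rewrite monoid.mulgVK.
  by rewrite monoid.mulgK.
exact: (skew_product_preserving (measurable_lamp_act h) (@coin2_lamp_act h)
  (fun x B _ => bij x B) mA).
Qed.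

Lemma zz_lamp_measure_equivalent : measure_equivalent zz lamp.
Proof.
exists _, coupling, coupling_measure, coupling_zz, coupling_lamp; split.
  exact: borel_retract_standard (borel_retract_zz borel_retract_pair).
have mF : measurable [set w : coupling | w.2 = gone].
  rewrite (_ : [set _ | _] = setT `*` [set gone]); first exact: measurableX.
  by apply/seteqP; split=> -[x g] //= [].
have F1 : coupling_measure [set w : coupling | w.2 = gone] = 1%E.
  rewrite (_ : [set _ | _] = setT `*` [set gone]); last first.
    by apply/seteqP; split=> -[x g] //= [].
  by rewrite coupling_slab /zz_counting /counting asboolT // fset_set1 cardfs1.
split; first exact: sigma_finite_coupling.
split.
  apply: (@lt_le_trans _ _ 1%E); first exact: lte01.
  rewrite -F1; apply: le_measure => //; apply: mem_set; first exact: mF.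
  exact: measurableT.
split; first exact: coupling_zz_mp.
split; first exact: coupling_lamp_mp.
split.
  move=> k [x g] [] e; apply: (monoid.mulIg g); rewrite monoid.mul1g; exact: e.
split; first by move=> h [x g] [/lamp_act_free].
split; first by move=> k h [x g]; rewrite /coupling_zz /coupling_lamp /= monoid.mulgA.
have F_fin : (coupling_measure [set w :
  coupling | w.2 = gone] < +oo)%E by rewrite F1 ltry.
split; exists [set w : coupling | w.2 = gone]; split=> //; split=> // -[x g].
  exists g; split=> [|k /=]; first by rewrite /= monoid.mulVg.
  by move=> e; apply: (monoid.mulgI (ginv k)); rewrite e monoid.mulVg.
(* For the lamplighter, [(x, g)] is brought to the diagonal by the unique [h] with [h x = g x],
   which exists because the orbits agree. *)
have [h hg] := zz_act_lamp g x.
have F_inv k : (coupling_lamp (ginv k) (x, g)).2 = gone <-> lamp_act (ginv k) x =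
  zz_act g x.
  split=> [/monoid.divg1_eq/= ->|/esym/coc_uniq e]; first by rewrite cocP.
  by rewrite /coupling_lamp /= e monoid.mulgV.
exists (ginv h); split=> [|k].
  by apply/F_inv; rewrite monoid.invgK.
move=> /F_inv; rewrite -hg => /(free_action_inj lamp_act1 lamp_actM lamp_act_free) <-.
by rewrite monoid.invgK.
Qed.

End Coupling.

Theorem theorem10p2 :
  (* (i) not a quasi-isometry invariant *)
  (exists G H : groupType,
     finitely_generated G /\ finitely_generated H /\
     infinite_group G /\ infinite_group H /\
     quasi_isometric G H /\
     presentable_by_product G /\ ~ presentable_by_product H) /\
  (* (ii) not a measure equivalence invariant *)
  (exists G H : groupType,
     finitely_generated G /\ finitely_generated H /\
     infinite_group G /\ infinite_group H /\
     measure_equivalent G H /\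
     presentable_by_product G /\ ~ presentable_by_product H) /\
  (* (iii) not an orbit equivalence invariant *)
  (exists G H : groupType,
     finitely_generated G /\ finitely_generated H /\
     infinite_group G /\ infinite_group H /\
     (exists (dX : measure_display) (X : measurableType dX)
             (mu : probability X RR) (a : G -> X -> X)
             (dY : measure_display) (Y : measurableType dY)
             (nu : probability Y RR) (b : H -> Y -> Y),
        standard_borel X /\ standard_borel Y /\
        mp_action mu a /\ mp_action nu b /\
        free_action a /\ free_action b /\
        orbit_equivalent mu a nu b) /\
     presentable_by_product G /\ ~ presentable_by_product H).
Proof.
split; [|split].
- exists (lattice5 * lattice13)%type, lattice65; split.
    exists (prod_gens (gibbs_gens quats5) (gibbs_gens quats13)).
    exact: prod_generates.
  split; first by eexists; exact: gen_generates.
  split; first exact: (proj1 (prod_presentable infinite_lattice5 infinite_lattice13)).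
  split; first exact: infinite_lattice65.
  split; first exact: lattice_quasi_isometric.
  split; first exact: prod_presentable infinite_lattice5 infinite_lattice13.
  exact: lattice65_not_presentable.
- exists zz, lamp; split; first exact: zz_finitely_generated.
  split; first exact: lamp_finitely_generated.
  split; first exact: zz_infinite.
  split; first exact: lamp_infinite.
  split; first exact: zz_lamp_measure_equivalent.
  by split; [exact: zz_presentable|exact: lamp_not_presentable].
exists zz, lamp; split; first exact: zz_finitely_generated.
split; first exact: lamp_finitely_generated.
split; first exact: zz_infinite.
split; first exact: lamp_infinite.
split; last by split; [exact: zz_presentable|exact: lamp_not_presentable].
have borel := borel_retract_standard borel_retract_pair.
exists _, (bseq * bseq)%type, coin2, zz_act, _, (bseq * bseq)%type, coin2, lamp_act.
do 2!(split; first exact: borel).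
split; first exact: zz_mp_action.
split; first exact: lamp_mp_action.
split; first exact: zz_act_free.
split; first exact: lamp_act_free.
exact: zz_lamp_orbit_equivalent.
Qed.
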